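(* For every $\kappa \in \{2,3\}$ and every positive integer $k$, there are infinitely many $(3,2k)$-regular uniquely hamiltonian graphs of (vertex) connectivity exactly $\kappa$.
   Context: A graph is $(3,2k)$-regular if every vertex has degree $3$ or $2k$, and there is at least one vertex of degree $3$ and at least one vertex of degree $2k$. A graph is uniquely hamiltonian if it contains exactly one hamiltonian cycle.
   Formalization: The case κ = 3, k = 1 is excluded: a (3,2)-regular graph has a vertex of degree 2, so its connectivity is at most 2 and no such graph of connectivity 3 exists; all other κ in {2,3} and positive k are covered. *)

(* Defs.v *)
From mathcomp Require Import all_boot.

Set Implicit Arguments.
Unset Strict Implicit.
Unset Printing Implicit Defensive.

(* Finite simple graphs. *)
Record sgraph := SGraph {
  vertex :> finType;
  adj : rel vertex;
  adj_sym : symmetric adj;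
  adj_irrefl : irreflexive adj
}.

Definition isomorphic (G H : sgraph) : Prop :=
  exists f : G -> H, bijective f /\ forall x y : G, adj (f x) (f y) = adj x y.

(* Graphs are counted up to isomorphism. *)
Definition infinitely_many_graphs (P : sgraph -> Prop) : Prop :=
  exists G : nat -> sgraph,
    (forall i, P (G i)) /\ (forall i j, i <> j -> ~ isomorphic (G i) (G j)).

Definition degree (G : sgraph) (v : G) : nat := #|[set w : G | adj v w]|.

(* "(a, b)-regular": both degrees have to occur. *)
Definition biregular (a b : nat) (G : sgraph) : Prop :=
  [/\ forall v : G, degree v = a \/ degree v = b,
      exists v : G, degree v = a
    & exists v : G, degree v = b].

Definition cycle_edges (G : sgraph) (c : seq G) : {set {set G}} :=
  [set [set x; next c x] | x in c].

(* A hamiltonian cycle is identified with its set of edges, so that the choice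
   of a starting vertex and of a direction of traversal is immaterial.  The
   bound on the size excludes the closed walk x, y, x along a single edge,
   which [cycle] accepts. *)
Definition hamiltonian_cycle (G : sgraph) (C : {set {set G}}) : Prop :=
  exists c : seq G,
    [/\ 2 < size c, uniq c, cycle (@adj G) c, c =i G & C = cycle_edges c].

Definition uniquely_hamiltonian (G : sgraph) : Prop :=
  exists! C : {set {set G}}, hamiltonian_cycle C.

(* Adjacency in the graph obtained by deleting the vertices of S. *)
Definition del_adj (G : sgraph) (S : {set G}) : rel G :=
  [rel x y | [&& x \notin S, y \notin S & adj x y]].

Definition del_connected (G : sgraph) (S : {set G}) : bool :=
  [forall x, forall y,
     (x \notin S) ==> (y \notin S) ==> connect (del_adj S) x y].

Definition k_connected (G : sgraph) (k : nat) : bool :=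
  (k < #|G|) && [forall S : {set G}, (#|S| < k) ==> del_connected S].

(* The vertex connectivity: the greatest k such that G is k-connected (in
   particular n - 1 for the complete graph on n > 0 vertices). *)
Definition connectivity (G : sgraph) : nat :=
  \max_(k < #|G| | k_connected G k) k.

(* Main.v *)
Require Import Defs.
From HB Require Import structures.
From mathcomp Require Import all_boot.

(* Copies of one gadget are arranged in a ring. A copy has a vertex [Y] of
   degree 2r + 2, three cubic vertices [One], [Two], [Q], and a strip of r
   blocks of six cubic vertices each, two of which are joined to [Y]. Three
   edges leave a copy: one from [Q] to the end of the strip of the preceding
   copy, one from the end of the strip to [Q] of the following copy, and one
   joining the end of the other rail of the strip to the same vertex of a
   fixed mate of the copy.
   If a hamiltonian cycle enters a copy at [Q], then, since a cubic vertex
   misses exactly one of its edges and no short cycle may close, it is forced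
   in the whole copy and leaves at the end of the strip, hence is forced all
   around the ring. If it enters no copy at [Q], it cannot leave a copy and
   its mate. The graph has connectivity 3 when mates are opposite copies of
   the ring (and r > 0), and 2 when they are neighbours. *)

Set Implicit Arguments.
Unset Strict Implicit.
Unset Printing Implicit Defensive.

(** * Hamiltonian cycles as 2-regular relations *)

Lemma next_neq_prev (T : eqType) (c : seq T) (x : T) :
  2 < size c -> uniq c -> x \in c -> next c x != prev c x.
Proof.
move=> c3 Uc /rot_to[i p Ep].
have Up : uniq (x :: p) by rewrite -Ep rot_uniq.
have : 2 < size (x :: p) by rewrite -Ep size_rot.
rewrite -(next_rot i Uc) -(prev_rot i Uc) Ep.
case: p Up {Ep} => [|y [|z p]] // Up _.
have -> : next [:: x, y, z & p] x = y by rewrite /= eqxx.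
(* If [y] were also the predecessor of [x], its successor would be [x], whereas it is [z]. *)
apply/eqP => Eyx; have := next_prev Up x; rewrite -Eyx /=.
move: Up; rewrite /= !inE !negb_or => /andP[/and3P[xy xz _] _].
by rewrite (eq_sym y) (negbTE xy) eqxx => /eqP; rewrite eq_sym (negbTE xz).
Qed.

(* What the proof uses of the edge set of a hamiltonian cycle: it is
   2-regular, and no proper nonempty set of vertices is closed under it. *)
Record ham_rel (G : sgraph) (L : rel G) : Prop := HamRel {
  ham_rel_sym : symmetric L;
  ham_rel_adj : subrel L (@adj G);
  ham_rel_two : forall u, exists a b, a != b /\ L u =1 pred2 a b;
  ham_rel_closed : forall X : pred G, (exists u, X u) ->
    (forall u v, X u -> L u v -> X v) -> forall v, X v
}.

Definition cycle_rel (G : sgraph) (c : seq G) : rel G :=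
  fun u v => (v == next c u) || (u == next c v).

Lemma cycle_ham_rel (G : sgraph) (c : seq G) :
  2 < size c -> uniq c -> cycle (@adj G) c -> c =i G -> ham_rel (cycle_rel c).
Proof.
move=> c3 Uc Ac cG; have in_c x : x \in c by rewrite cG.
have Lprev u v : (u == next c v) = (v == prev c u).
  by apply/eqP/eqP => ->; rewrite ?prev_next ?next_prev.
split=> [u v | u v | u | X [u Xu] clX v].
- by rewrite /cycle_rel orbC.
- by case/orP=> /eqP->; [|rewrite adj_sym]; apply: next_cycle.
- exists (next c u), (prev c u); split; first exact: next_neq_prev.
  by move=> v; rewrite /cycle_rel (Lprev u v).
have: fconnect (next c) u v by rewrite (fconnect_cycle (cycle_next Uc) (in_c u)).
move/iter_findex <-; elim: (findex _ _ _) => //= n IHn.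
by apply: (clX _ _ IHn); rewrite /cycle_rel eqxx.
Qed.

Lemma mem_cycle_edges (G : sgraph) (c : seq G) (E : {set G}) : c =i G ->
  reflect (exists u v, cycle_rel c u v /\ E = [set u; v]) (E \in cycle_edges c).
Proof.
move=> cG; apply: (iffP imsetP) => [[u _ ->] | [u [v [/orP[]/eqP-> ->]]]].
- by exists u, (next c u); rewrite /cycle_rel eqxx.
- by exists u; rewrite ?cG.
by exists v; rewrite ?cG // setUC.
Qed.

Section HamRel.
Variables (G : sgraph) (L : rel G).
Hypothesis hamL : ham_rel L.

Lemma ham_count u (s : seq G) :
  uniq s -> (forall v, adj u v -> v \in s) -> count (L u) s = 2.
Proof.
move=> Us sub; have [a [b [ab Lu]]] := ham_rel_two hamL u.
have Lsub v : L u v -> v \in s by move/(ham_rel_adj hamL)/sub.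
rewrite -size_filter (@perm_size _ _ [:: a; b]) //; apply: uniq_perm.
- exact: filter_uniq.
- by rewrite /= inE ab.
move=> v; rewrite mem_filter !inE; have := Lu v; rewrite /= => <-.
by apply/andP/idP => [[]|Luv] //; split=> //; apply: Lsub.
Qed.

End HamRel.

(** * The graphs *)

Inductive hub := Y | One | Two | Q.

Definition hub_code h :=
  match h with
  | Y => (false, false) | One => (false, true)
  | Two => (true, false) | Q => (true, true)
  end.

Definition hub_decode c :=
  match c with
  | (false, false) => Y | (false, true) => One
  | (true, false) => Two | (true, true) => Q
  end.

Lemma hub_codeK : cancel hub_code hub_decode.
Proof. by case. Qed.

HB.instance Definition _ := Finite.copy hub (can_type hub_codeK).

Inductive site := B0 | B1 | B2 | B3 | B4 | B5.

Definition site_code t :=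
  match t with
  | B0 => (false, false, false) | B1 => (false, false, true)
  | B2 => (false, true, false) | B3 => (false, true, true)
  | B4 => (true, false, false) | B5 => (true, false, true)
  end.

Definition site_decode c :=
  match c with
  | (false, false, false) => B0 | (false, false, true) => B1
  | (false, true, false) => B2 | (false, true, true) => B3
  | (true, false, false) => B4 | _ => B5
  end.

Lemma site_codeK : cancel site_code site_decode.
Proof. by case. Qed.

HB.instance Definition _ := Finite.copy site (can_type site_codeK).

Lemma card_hub : #|{: hub}| = 4.
Proof.
rewrite -(card_codom (can_inj hub_codeK)) -[4]/(2 * 2) -!card_bool -card_prod.
by apply: eq_card => -[[] []]; rewrite inE; apply/codomP;
  [exists Q | exists Two | exists One | exists Y].
Qed.

Lemma card_site : #|{: site}| = 6.
Proof.
pose s := [:: B0; B1; B2; B3; B4; B5].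
by rewrite -[6]/(size s) -(card_uniqP (isT : uniq s)); apply: eq_card => -[].
Qed.

(* Degree constraints at the sites of a block: [a_st] tells whether the edge
   [Bs]-[Bt] is used, [y0] and [y5] concern the edges to [Y], [sA] and [sB] the
   edges entering at [B1] and [B3], [oA] and [oB] those leaving [B4] and [B5]. *)
Definition block_ok (a01 a12 a23 a34 a40 a25 y0 y5 sA sB oA oB : bool) : bool :=
  [&& a01 + a40 + y0 == 2, a01 + a12 + sA == 2, a12 + a23 + a25 == 2,
      a23 + a34 + sB == 2, a34 + a40 + oA == 2 & a25 + y5 + oB == 2].

Section BlockOk.
Variables a01 a12 a23 a34 a40 a25 y0 y5 sA sB oA oB : bool.
Hypothesis ok : block_ok a01 a12 a23 a34 a40 a25 y0 y5 sA sB oA oB.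

Local Ltac edge_cases :=
  move: ok; rewrite /block_ok; case: sA; case: sB; case: y0; case: y5 => //=;
  case: a01; case: a40 => //=; case: a12; case: a25 => //=;
  case: a23; case: a34 => //=; case: oA; case: oB.

(** The single strand entering at [B3] runs through [B4], [B0], [B1], [B2], [B5] and leaves on its
    own rail. This is the pattern of the intended hamiltonian cycle. *)
Lemma ok_quietB : ~~ y0 -> ~~ y5 -> ~~ sA -> sB ->
  [/\ [&& a34, a40, a01, a12 & a25], oB & ~~ oA].
Proof. by edge_cases. Qed.

(** Two strands cross the block, [B3], [B2], [B5] and [B1], [B0], [B4], one on each rail. *)
Lemma ok_quietAB : ~~ y0 -> ~~ y5 -> sA -> sB -> [/\ a23, a25, oA & oB].
Proof. by edge_cases. Qed.

Lemma ok_AB0 : y0 -> ~~ y5 -> sA -> sB -> a34 /\ a40.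
Proof. by edge_cases. Qed.

Lemma ok_AB5 : ~~ y0 -> y5 -> sA -> sB -> a23 /\ a25.
Proof. by edge_cases. Qed.

Lemma ok_B0 : y0 -> ~~ y5 -> ~~ sA -> sB -> [/\ a01, a12, a25, oA & oB].
Proof. by edge_cases. Qed.

(** Each of the two outgoing edges is used exactly when [a23] is. *)
Lemma ok_B5 : ~~ y0 -> y5 -> ~~ sA -> sB -> oA = oB.
Proof. by edge_cases. Qed.

Lemma ok_B05 : y0 -> y5 -> ~~ sA -> sB -> [/\ a01, a12 & a25].
Proof. by edge_cases. Qed.

(** [B1] and [B3] use both their edges inside the block, which excludes [a25]. Then [B5] needs [y5],
    so [y0] fails and the 5-cycle closes. *)
Lemma ok_none : ~~ (y0 && y5) -> ~~ sA -> ~~ sB ->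
  [&& a01, a12, a23, a34 & a40].
Proof. by edge_cases. Qed.

End BlockOk.

Section Graph.

Variables (I : finType) (nxt prv mate : I -> I) (r : nat).
Hypotheses (nxtK : cancel nxt prv) (prvK : cancel prv nxt).
Hypotheses (mateK : involutive mate) (mate_neq : forall i, mate i != i).

Local Notation loc := (hub + 'I_r * site)%type.
Local Notation vert := (I * (hub + 'I_r * site))%type.

(* Block [j] is the 5-cycle [B0] ... [B4] with [B5] pendant at [B2]; the junk
   value for [r <= j] is [Q]. *)
Definition blk (j : nat) (t : site) : loc :=
  if insub j is Some o then inr (o, t) else inl Q.

(* Two rails run along the strip: [srcA j] and [srcB j] are the vertices from
   which they enter block [j], and [outA i j], [outB i j] the vertices they
   enter, in another copy when [j = r]. *)
Definition srcA j : loc := if j is j'.+1 then blk j' B4 else inl Q.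
Definition srcB j : loc := if j is j'.+1 then blk j' B5 else inl One.
Definition outA i j : vert := if j < r then (i, blk j B1) else (mate i, srcA r).
Definition outB i j : vert := if j < r then (i, blk j B3) else (nxt i, inl Q).

Definition nb_hub (i : I) h : seq vert :=
  match h with
  | Y => [:: (i, inl One), (i, inl Two) &
             [seq (i, blk j t) | j <- iota 0 r, t <- [:: B0; B5]]]
  | One => [:: (i, inl Y); (i, inl Two); outB i 0]
  | Two => [:: (i, inl Y); (i, inl One); (i, inl Q)]
  | Q => [:: (i, inl Two); outA i 0; (prv i, srcB r)]
  end.

Definition nb_site (i : I) j t : seq vert :=
  match t with
  | B0 => [:: (i, blk j B1); (i, blk j B4); (i, inl Y)]
  | B1 => [:: (i, blk j B0); (i, blk j B2); (i, srcA j)]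
  | B2 => [:: (i, blk j B1); (i, blk j B3); (i, blk j B5)]
  | B3 => [:: (i, blk j B2); (i, blk j B4); (i, srcB j)]
  | B4 => [:: (i, blk j B3); (i, blk j B0); outA i j.+1]
  | B5 => [:: (i, blk j B2); (i, inl Y); outB i j.+1]
  end.

Definition nb (u : vert) : seq vert :=
  match u.2 with inl h => nb_hub u.1 h | inr (o, t) => nb_site u.1 o t end.

(** * Symmetry and simplicity of the adjacency lists *)

Lemma blkE j (lt_jr : j < r) t : blk j t = inr (Ordinal lt_jr, t).
Proof. by rewrite /blk insubT. Qed.

Lemma nb_blk i j t : j < r -> nb (i, blk j t) = nb_site i j t.
Proof. by move=> lt_jr; rewrite blkE. Qed.

Variant loc_spec : loc -> Type :=
  | LocHub h : loc_spec (inl h)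
  | LocBlk j t of j < r : loc_spec (blk j t).

Lemma locP l : loc_spec l.
Proof.
case: l => [h | [o t]]; first by constructor.
suff -> : inr (o, t) = blk o t :> loc by constructor.
by rewrite /blk valK.
Qed.

Lemma mem_nb_Y i v : reflect
  (v = (i, inl One) \/ v = (i, inl Two) \/
   exists j t, [/\ j < r, t = B0 \/ t = B5 & v = (i, blk j t)])
  (v \in nb (i, inl Y)).
Proof.
rewrite !inE; apply: (iffP or3P).
  case=> [/eqP|/eqP|/allpairsP[[j t] /= [jr tE ->]]]; first by left.
    by right; left.
  move: jr tE; rewrite mem_iota !inE => /= jr tE; right; right; exists j, t.
  by split=> //; case/orP: tE => /eqP; [left | right].
move=> [->|[->|[j [t [jr tE ->]]]]]; [constructor 1 | constructor 2 |] => //.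
constructor 3; apply/allpairsP; exists (j, t); rewrite mem_iota !inE /=.
by split=> //; case: tE => ->.
Qed.

Lemma blk_eq j t j' t' : j < r -> j' < r ->
  (blk j t == blk j' t') = (j == j') && (t == t').
Proof. by move=> jr j'r; rewrite !blkE /eq_op /= /eq_op. Qed.

Lemma blk_hub j t h : j < r -> (blk j t == inl h) = false.
Proof. by move=> jr; rewrite blkE. Qed.

Lemma hub_blk j t h : j < r -> (inl h == blk j t) = false.
Proof. by move=> jr; rewrite blkE. Qed.

Lemma outA_last i j : j = r -> outA i j = (mate i, srcA j).
Proof. by move=> ->; rewrite /outA ltnn. Qed.

Lemma outB_last i j : j = r -> outB i j = (nxt i, inl Q).
Proof. by move=> ->; rewrite /outB ltnn. Qed.

Lemma outA_blk i j : j < r -> outA i j = (i, blk j B1).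
Proof. by move=> jr; rewrite /outA jr. Qed.

Lemma outB_blk i j : j < r -> outB i j = (i, blk j B3).
Proof. by move=> jr; rewrite /outB jr. Qed.

Lemma mem_outA i j : j <= r -> (i, srcA j) \in nb (outA i j).
Proof.
rewrite leq_eqVlt => /predU1P[jr|jr]; last first.
  by rewrite outA_blk // nb_blk // !inE eqxx !orbT.
rewrite outA_last //; case: j jr => [|j] jr.
  by rewrite !inE outA_last // mateK eqxx orbT.
by rewrite nb_blk -?jr // !inE outA_last // mateK eqxx !orbT.
Qed.

Lemma mem_outB i j : j <= r -> (i, srcB j) \in nb (outB i j).
Proof.
rewrite leq_eqVlt => /predU1P[jr|jr]; last first.
  by rewrite outB_blk // nb_blk // !inE eqxx !orbT.
by rewrite outB_last // !inE nxtK jr eqxx !orbT.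
Qed.

Lemma outA_mem i j : (j <= r) -> outA i j \in nb (i, srcA j).
Proof.
case: j => [|j] jr; first by rewrite !inE eqxx orbT.
by rewrite nb_blk // !inE eqxx !orbT.
Qed.

Lemma outB_mem i j : (j <= r) -> outB i j \in nb (i, srcB j).
Proof.
case: j => [|j] jr; first by rewrite !inE eqxx !orbT.
by rewrite nb_blk // !inE eqxx !orbT.
Qed.

Lemma nb_sym u v : v \in nb u -> u \in nb v.
Proof.
have nbA i j : j < r -> (i, blk j B1) \in nb (i, srcA j).
  by move=> jr; have := outA_mem i (ltnW jr); rewrite outA_blk.
have nbB i j : j < r -> (i, blk j B3) \in nb (i, srcB j).
  by move=> jr; have := outB_mem i (ltnW jr); rewrite outB_blk.
case: u => i l; case: (locP l) => [h | j t jr].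
  case: h => [/mem_nb_Y[->|[->|[j [t [jr tE ->]]]]]|||].
  - by rewrite !inE eqxx.
  - by rewrite !inE eqxx.
  - by rewrite nb_blk //; case: tE => ->; rewrite !inE eqxx ?orbT.
  - rewrite !inE => /or3P[]/eqP->; rewrite ?inE ?eqxx ?orbT //.
    exact: (@mem_outB i 0).
  - by rewrite !inE => /or3P[]/eqP->; rewrite ?inE ?eqxx ?orbT.
  rewrite !inE => /or3P[]/eqP->; rewrite ?inE ?eqxx ?orbT //.
    exact: (@mem_outA i 0).
  by have := @outB_mem (prv i) r (leqnn r); rewrite outB_last ?prvK.
have [inY0 inY5] : (i, blk j B0) \in nb (i, inl Y) /\ (i, blk j B5) \in nb (i, inl Y).
  by split; apply/mem_nb_Y; right; right; exists j; [exists B0|exists B5];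
    split; auto.
rewrite nb_blk //; case: t; rewrite !inE => /or3P[]/eqP->;
  rewrite ?nb_blk ?inE ?eqxx ?orbT ?nbA ?nbB ?mem_outA ?mem_outB //;
  by [exact: (@mem_outA i j.+1) | exact: (@mem_outB i j.+1)].
Qed.

Lemma srcA_cases j : j <= r ->
  srcA j = inl Q \/ exists2 j', j' < r & srcA j = blk j' B4.
Proof. by case: j => [|j] jr; [left | right; exists j]. Qed.

Lemma srcB_cases j : j <= r ->
  srcB j = inl One \/ exists2 j', j' < r & srcB j = blk j' B5.
Proof. by case: j => [|j] jr; [left | right; exists j]. Qed.

Lemma outA_cases i j : j <= r ->
  [\/ (j < r) /\ outA i j = (i, blk j B1),
     outA i j = (mate i, inl Q) |
     exists2 j', j' < r & outA i j = (mate i, blk j' B4)].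
Proof.
rewrite leq_eqVlt => /predU1P[jr|jr]; last by rewrite outA_blk //; constructor 1.
rewrite outA_last //; have [->|[j' j'r ->]] := srcA_cases (eq_leq jr).
  by constructor 2.
by constructor 3; exists j'.
Qed.

Lemma outB_cases i j : j <= r ->
  (j < r) /\ outB i j = (i, blk j B3) \/ outB i j = (nxt i, inl Q).
Proof.
rewrite leq_eqVlt => /predU1P[jr|jr]; last by rewrite outB_blk //; left.
by rewrite outB_last //; right.
Qed.

Lemma nb_irrefl u : u \notin nb u.
Proof.
have mi i : (i == mate i) = false by rewrite eq_sym (negbTE (mate_neq i)).
have eqE := (xpair_eqE, blk_eq, blk_hub, hub_blk, mi, eqxx).
case: u => i l; case: (locP l) => [h | j t jr].
  case: h.
  - apply/negP => /mem_nb_Y[|[|[j [t [jr _]]]]] // [] /eqP.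
    by rewrite hub_blk.
  - rewrite !inE; have [[r0 ->]|->] := outB_cases i (leq0n r);
      by rewrite !eqE ?andbF.
  - by rewrite !inE !eqE.
  rewrite !inE; have [[jr ->]|->|[j jr ->]] := outA_cases i (leq0n r);
  have [->|[j' j'r ->]] := srcB_cases (leqnn r); by rewrite !eqE ?andbF.
rewrite nb_blk //; case: t; rewrite !inE.
- by rewrite !eqE ?andbF.
- by have [->|[j' j'r ->]] := srcA_cases (ltnW jr); rewrite !eqE ?andbF.
- by rewrite !eqE ?andbF.
- by have [->|[j' j'r ->]] := srcB_cases (ltnW jr); rewrite !eqE ?andbF.
- by have [[j'r ->]|->|[j' j'r ->]] := outA_cases i jr; rewrite !eqE ?andbF.
by have [[j'r ->]|->] := outB_cases i jr; rewrite !eqE ?andbF.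
Qed.

Lemma nb_uniq u : uniq (nb u).
Proof.
have eqE := (xpair_eqE, blk_eq, blk_hub, hub_blk, eqxx).
case: u => i l; case: (locP l) => [h | j t jr].
  rewrite -[nb _]/(nb_hub i h); case: h; rewrite /nb_hub.
  - rewrite !cons_uniq inE negb_or -andbA; apply/and4P; split.
    + by rewrite !eqE.
    + by apply/allpairsP => -[[j t] [/=]]; rewrite mem_iota => jr _ [] /eqP;
        rewrite hub_blk.
    + by apply/allpairsP => -[[j t] [/=]]; rewrite mem_iota => jr _ [] /eqP;
        rewrite hub_blk.
    apply: allpairs_uniq => [||[j t] [j' t']]; rewrite ?iota_uniq //.
    move=> /allpairsP[[? ?] [jr _ [-> ->]]].
    move=> /allpairsP[[? ?] [j'r _ [-> ->]]] [/eqP].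
    rewrite !mem_iota /= in jr j'r.
    by rewrite blk_eq // => /andP[/eqP-> /eqP->].
  - rewrite /= !inE; have [[r0 ->]|->] := outB_cases i (leq0n r);
      by rewrite !eqE ?andbF.
  - by rewrite /= !inE !eqE.
  rewrite /= !inE; have [[jr ->]|->|[j jr ->]] := outA_cases i (leq0n r);
  have [->|[j' j'r ->]] := srcB_cases (leqnn r); by rewrite !eqE ?andbF.
rewrite nb_blk //; case: t; rewrite /= !inE.
- by rewrite !eqE ?andbF.
- by have [->|[j' j'r ->]] := srcA_cases (ltnW jr); rewrite !eqE ?andbF.
- by rewrite !eqE ?andbF.
- by have [->|[j' j'r ->]] := srcB_cases (ltnW jr); rewrite !eqE ?andbF.
- by have [[j'r ->]|->|[j' j'r ->]] := outA_cases i jr; rewrite !eqE ?andbF.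
by have [[j'r ->]|->] := outB_cases i jr; rewrite !eqE ?andbF.
Qed.

(** Serves twice: to trap a cycle inside a copy and its mate, and to verify the cut with two
    vertices. *)
Lemma nb_out u v : v \in nb u ->
  [\/ v.1 = u.1,
     u = (u.1, srcA r) /\ v = (mate u.1, srcA r),
     u = (u.1, srcB r) /\ v = (nxt u.1, inl Q) |
     u = (u.1, inl Q) /\ v = (prv u.1, srcB r)].
Proof.
have oA i j : j <= r -> (outA i j).1 = i \/
    (i, srcA j) = (i, srcA r) /\ outA i j = (mate i, srcA r).
  rewrite leq_eqVlt => /predU1P[jr|jr]; last by rewrite outA_blk //; left.
  by rewrite outA_last // (congr1 srcA jr); right.
have oB i j : j <= r -> (outB i j).1 = i \/
    (i, srcB j) = (i, srcB r) /\ outB i j = (nxt i, inl Q).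
  rewrite leq_eqVlt => /predU1P[jr|jr]; last by rewrite outB_blk //; left.
  by rewrite outB_last // (congr1 srcB jr); right.
case: u => i l; case: (locP l) => [h | j t jr].
  case: h => [/mem_nb_Y[->|[->|[j [t [jr tE ->]]]]]|||]; try by constructor 1.
  - rewrite !inE => /or3P[]/eqP->; try by constructor 1.
    have [->|[E ->]] := oB i 0 (leq0n r); first by constructor 1.
    by constructor 3.
  - by rewrite !inE => /or3P[]/eqP->; constructor 1.
  rewrite !inE => /or3P[]/eqP->; first by constructor 1.
    have [->|[E ->]] := oA i 0 (leq0n r); first by constructor 1.
    by constructor 2.
  by constructor 4.
rewrite nb_blk //; case: t; rewrite !inE => /or3P[]/eqP->; try by constructor 1.
  have [->|[E ->]] := oA i j.+1 jr; first by constructor 1.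
  by constructor 2.
have [->|[E ->]] := oB i j.+1 jr; first by constructor 1.
by constructor 3.
Qed.

Definition nb_adj : rel vert := fun u v => v \in nb u.

Lemma nb_adj_sym : symmetric nb_adj.
Proof. by move=> u v; apply/idP/idP; apply: nb_sym. Qed.

Lemma nb_adj_irrefl : irreflexive nb_adj.
Proof. by move=> u; apply: negbTE (nb_irrefl u). Qed.

Definition gr : sgraph := SGraph nb_adj_sym nb_adj_irrefl.

(** * Degrees, number of vertices and an explicit hamiltonian cycle *)

Lemma gr_degree (u : gr) : degree u = size (nb u).
Proof. by rewrite /degree cardsE; apply/card_uniqP/nb_uniq. Qed.

Lemma gr_degree_Y i : @degree gr (i, inl Y) = 2 * r.+1.
Proof.
rewrite gr_degree.
rewrite -[size _]/(size [seq (i, blk j t) | j <- iota 0 r, t <- [:: B0; B5]]).+2.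
by rewrite size_allpairs size_iota muln2 mul2n doubleS.
Qed.

Lemma gr_degree3 i l : l != inl Y -> @degree gr (i, l) = 3.
Proof. by rewrite gr_degree; case: l => [[]|[o []]]. Qed.

Lemma card_gr : #|gr| = #|I| * (4 + r * 6).
Proof. by rewrite card_prod card_sum card_hub card_prod card_ord card_site. Qed.

(** The successor map of the hamiltonian cycle, which goes once around the ring and uses no edge
    between mates. *)
Definition next_vert (u : vert) : vert :=
  let: (i, l) := u in
  match l with
  | inl Q => (i, inl Two) | inl Two => (i, inl Y) | inl Y => (i, inl One)
  | inl One => outB i 0
  | inr (o, t) =>
    match t with
    | B3 => (i, inr (o, B4)) | B4 => (i, inr (o, B0)) | B0 => (i, inr (o, B1))
    | B1 => (i, inr (o, B2)) | B2 => (i, inr (o, B5)) | B5 => outB i o.+1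
    end
  end.

Definition prev_vert (u : vert) : vert :=
  let: (i, l) := u in
  match l with
  | inl Q => (prv i, srcB r) | inl Two => (i, inl Q) | inl Y => (i, inl Two)
  | inl One => (i, inl Y)
  | inr (o, t) =>
    match t with
    | B3 => (i, srcB o) | B4 => (i, inr (o, B3)) | B0 => (i, inr (o, B4))
    | B1 => (i, inr (o, B0)) | B2 => (i, inr (o, B1)) | B5 => (i, inr (o, B2))
    end
  end.

Lemma prev_vert_outB i j : j <= r -> prev_vert (outB i j) = (i, srcB j).
Proof.
rewrite leq_eqVlt => /predU1P[jr|jr]; last by rewrite outB_blk // blkE.
by rewrite outB_last //= nxtK jr.
Qed.

Lemma next_vert_srcB i j : j <= r -> next_vert (i, srcB j) = outB i j.
Proof. by case: j => // j jr; rewrite /= blkE. Qed.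

Lemma next_vertK : cancel next_vert prev_vert.
Proof.
case=> i l; case: (locP l) => [[]|j [] jr] //; last first.
  by rewrite (@next_vert_srcB i j.+1) // prev_vert_outB.
all: by rewrite ?blkE // (@prev_vert_outB i 0).
Qed.

Lemma next_vert_adj u : nb_adj u (next_vert u).
Proof.
have Bj i j : j <= r -> outB i j \in nb (i, srcB j) by apply: outB_mem.
case: u => i l; case: (locP l) => [h | j t jr].
  by case: h; rewrite /nb_adj /= ?(@Bj i 0) // !inE eqxx ?orbT.
rewrite /nb_adj nb_blk // blkE; case: t; rewrite /= !inE ?blkE ?eqxx ?orbT //.
Qed.

Hypothesis nxt_conn : forall i j, fconnect nxt i j.

Lemma next_vert_conn u v : fconnect next_vert u v.
Proof.
have step w : fconnect next_vert w (next_vert w) by apply: fconnect1.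
(* The orbit of [Q] covers its copy and reaches [Q] of the next copy, so connectedness of the ring
   under [nxt] finishes. *)
suff QtoAll i l : fconnect next_vert (i, inl Q) (i, l) /\
                  fconnect next_vert (i, inl Q) (nxt i, inl Q).
  have QQ i i' : fconnect next_vert (i, inl Q) (i', inl Q).
    rewrite -(iter_findex (nxt_conn i i')); elim: findex => //= n IHn.
    by apply: connect_trans IHn _; case: (QtoAll (iter n nxt i) (inl Q)).
  case: u v => i l [i' l']; apply: (@connect_trans _ _ (i, inl Q)).
    by rewrite fconnect_sym ?(proj1 (QtoAll _ _)) //; apply: can_inj next_vertK.
  by apply: connect_trans (QQ i i') (proj1 (QtoAll _ _)).
have tr w w' : fconnect next_vert w w' -> fconnect next_vert w (next_vert w').
  by move=> ww'; apply: connect_trans ww' (step w').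
pose q : vert := (i, inl Q); have q0 : fconnect next_vert q q := connect0 _ _.
have qt : fconnect next_vert q (i, inl Two) := tr _ _ q0.
have qy : fconnect next_vert q (i, inl Y) := tr _ _ qt.
have q1 : fconnect next_vert q (i, inl One) := tr _ _ qy.
have inB j : j < r -> fconnect next_vert q (i, srcB j) ->
    forall t, fconnect next_vert q (i, blk j t).
  move=> jr qB; have q3 : fconnect next_vert q (i, blk j B3).
    by rewrite -outB_blk // -next_vert_srcB ?(ltnW jr) //; apply: tr.
  move: q3; rewrite blkE => q3; have q4 := tr _ _ q3; have q0' := tr _ _ q4.
  by have q1' := tr _ _ q0'; have q2 := tr _ _ q1'; have q5 := tr _ _ q2; case;
    rewrite blkE.
have qB j : j <= r -> fconnect next_vert q (i, srcB j).
  by elim: j => // j IHj jr; apply: (inB j jr (IHj (ltnW jr)) B5).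
split.
  case: (locP l) => [|j t jr]; last by apply: inB (qB _ (ltnW jr)) _.
  by case.
by rewrite -(@outB_last i r) // -next_vert_srcB //; apply: tr; apply: qB.
Qed.


(** * Uniqueness of the hamiltonian cycle *)

Hypothesis third : forall i, exists2 i', i' != i & i' != mate i.

Section Ham.

Variable L : rel gr.
Hypothesis hamL : ham_rel L.

Let Lsym := ham_rel_sym hamL.

Lemma ham_nb u : count (L u) (nb u) = 2.
Proof. exact: (ham_count hamL (nb_uniq u)). Qed.

Lemma ham_three u a b c : L u a -> L u b -> L u c -> uniq [:: a; b; c] -> False.
Proof.
have [x [y [_ Lu]]] := ham_rel_two hamL u; rewrite !Lu /= !inE.
by move=> /orP[]/eqP-> /orP[]/eqP-> /orP[]/eqP->; rewrite ?eqxx ?orbT ?andbF.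
Qed.

(** Each vertex of [s] has its two used edges already, to its successor and its predecessor in [s],
    so [s] is closed under [L]. *)
Lemma ham_cycle_all (s : seq gr) w :
  2 < size s -> uniq s -> cycle L s -> w \in s.
Proof.
move=> s3 Us cyc; apply: (@ham_rel_closed _ _ hamL (fun v => v \in s)) w.
  by case: s s3 {Us cyc} => // x s _; exists x; apply: mem_head.
move=> u v; cbv beta => us Luv; have Ln := next_cycle cyc us; have Lp := prev_cycle cyc us.
have np := next_neq_prev s3 Us us; rewrite Lsym in Lp.
have [->|vn] := eqVneq v (next s u); first by rewrite mem_next.
have [->|vp] := eqVneq v (prev s u); first by rewrite mem_prev.
case: (ham_three Luv Ln Lp); rewrite /= !inE negb_or vn vp.
by rewrite np.
Qed.

Lemma ham_no_cycle (s : seq gr) w :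
  2 < size s -> uniq s -> w \notin s -> cycle L s -> False.
Proof. by move=> s3 Us ws cyc; rewrite (ham_cycle_all w s3 Us cyc) in ws. Qed.

(** * Forcing of the cycle inside one copy *)

Section Copy.

Variable i : I.
Let e (l l' : loc) := L (i, l) (i, l').
Let ebl j t t' := e (blk j t) (blk j t').
(** [T] and [U] concern the edges from [Y] into block [j], [A] and [B] the rail edges into block
    [j], or out of the copy when [j = r]. *)
Let T j := e (inl Y) (blk j B0).
Let U j := e (inl Y) (blk j B5).
Let A j := L (i, srcA j) (outA i j).
Let B j := L (i, srcB j) (outB i j).

Lemma site_ok j : j < r ->
  block_ok (ebl j B0 B1) (ebl j B1 B2) (ebl j B2 B3) (ebl j B3 B4) (ebl j B4 B0)
    (ebl j B2 B5) (T j) (U j) (A j) (B j) (A j.+1) (B j.+1).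
Proof.
move=> jr; have N t : count (L (i, blk j t)) (nb_site i j t) = 2.
  by rewrite -nb_blk // ham_nb.
have es l l' : e l l' = e l' l by apply: Lsym.
have Aj : A j = e (blk j B1) (srcA j) by rewrite /A outA_blk // Lsym.
have Bj : B j = e (blk j B3) (srcB j) by rewrite /B outB_blk // Lsym.
rewrite /block_ok /ebl /T /U Aj Bj.
apply/and5P; split; last (apply/andP; split); apply/eqP.
- by rewrite -(N B0) /= addn0 addnA (es (blk j B4)) (es (inl Y)).
- by rewrite -(N B1) /= addn0 addnA (es (blk j B0)).
- by rewrite -(N B2) /= addn0 addnA (es (blk j B1)).
- by rewrite -(N B3) /= addn0 addnA (es (blk j B2)).
- by rewrite -(N B4) /= addn0 addnA (es (blk j B3)).
by rewrite -(N B5) /= addn0 addnA (es (blk j B2)) (es (inl Y)).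
Qed.

Lemma hub_ok :
  [/\ e (inl Y) (inl One) + e (inl One) (inl Two) + B 0 = 2,
      e (inl Y) (inl Two) + e (inl One) (inl Two) + e (inl Two) (inl Q) = 2 &
      e (inl Two) (inl Q) + A 0 + L (i, inl Q) (prv i, srcB r) = 2].
Proof.
have es l l' : e l l' = e l' l by apply: Lsym.
split.
- by rewrite -(ham_nb (i, inl One)) /= addn0 addnA (es (inl Y)).
- rewrite -(ham_nb (i, inl Two)) /= addn0 addnA (es (inl Y)).
  by rewrite (es (inl One)).
by rewrite -(ham_nb (i, inl Q)) /= addn0 addnA (es (inl Two)).
Qed.

(** Used to prolong a strand from [Y] through a new block: it stays simple and still misses [Q], so
    closing it would give a proper cycle. *)
Lemma strand_cat j (p : seq gr) t1 t2 t3 :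
  j < r -> uniq ((i, inl Y) :: p) -> (i, inl Q) \notin p ->
  (forall t, (i, blk j t) \notin p) -> uniq [:: t1; t2; t3] ->
  let q := p ++ [:: (i, blk j t1); (i, blk j t2); (i, blk j t3)] in
  uniq ((i, inl Y) :: q) /\ (i, inl Q) \notin q.
Proof.
have eqE := (xpair_eqE, blk_eq, blk_hub, hub_blk, eqxx).
move=> jr /= /andP[Yp Up] Qp jp Ut; rewrite cat_uniq !mem_cat !negb_or Yp Up Qp.
move: Ut; rewrite /= !inE !negb_or (negbTE (jp t1)) (negbTE (jp t2)).
by rewrite (negbTE (jp t3)) !eqE.
Qed.

(* If the cycle runs from [Y] along [p] to the source of [B j] and both edges
   into block [j] are used, then this strand can only return to [Y] at the
   first block whose edges to [Y] are used, closing a short cycle. *)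
Lemma strand_absurd m j t z (p : seq gr) :
  j + m < r -> t = B0 \/ t = B5 -> e (inl Y) (blk (j + m) t) ->
  path L (i, inl Y) p -> last (i, inl Y) p = (i, srcB j) ->
  uniq ((i, inl Y) :: p) -> (i, inl Q) \notin p ->
  (forall j' t', j <= j' -> j' < r -> (i, blk j' t') \notin p) ->
  z \in p -> L (i, inl Y) z -> A j -> B j -> False.
Proof.
have eqE := (xpair_eqE, blk_eq, blk_hub, hub_blk, eqxx).
elim: m j p => [|m IHm] j p jmr tE Lt Lp lastp Up Qp jp zp Lz Aj Bj;
  have jr : j < r := leq_ltn_trans (leq_addr _ _) jmr.
all: have ok := site_ok jr.
all: have Bj3 : L (i, srcB j) (i, blk j B3) by rewrite -outB_blk.
all: have zn j' t' : j <= j' -> j' < r -> z != (i, blk j' t')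
  by move=> jj' j'r; apply: contraNneq (jp j' t' jj' j'r) => <-.
all: have jpj t' : (i, blk j t') \notin p by apply: jp.
(* [Y] already uses the edge to [z], which is outside block [j], so at most one of its used edges
   leads into the block. *)
- have Tn t1 t2 : e (inl Y) (blk j t1) -> e (inl Y) (blk j t2) -> t1 = t2.
    move=> L1 L2; apply/eqP/idPn => n12; apply: (ham_three Lz L1 L2).
    by rewrite /= !inE negb_or !zn // !eqE //= n12.
  have close t1 t2 t3 : uniq [:: t1; t2; t3] ->
      path L (i, srcB j) [:: (i, blk j t1); (i, blk j t2); (i, blk j t3); (i, inl Y)] -> False.
    move=> Ut Lt'.
    have cyc : cycle L ((i, inl Y) :: p ++ [:: (i, blk j t1); (i, blk j t2); (i, blk j t3)]).
      by rewrite /= rcons_cat cat_path Lp lastp.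
    have [Uq Qq] := strand_cat jr Up Qp jpj Ut.
    have s3 : 2 < size ((i, inl Y) :: p ++ [:: (i, blk j t1); (i, blk j t2); (i, blk j t3)]).
      by rewrite /= size_cat addn3.
    by have := ham_cycle_all (i, inl Q) s3 Uq cyc; rewrite in_cons (negbTE Qq) xpair_eqE eqxx.
  rewrite addn0 in Lt; case: tE Lt => -> Lt.
    have [] := ok_AB0 ok Lt _ Aj Bj.
      by apply/negP => /(Tn _ _ Lt).
    move=> a34 a40; apply: (close B3 B4 B0) => //=.
    by apply/and5P; split=> //; rewrite Lsym.
  have [] := ok_AB5 ok _ Lt Aj Bj.
    by apply/negP => /(Tn _ _ Lt).
  move=> a23 a25; apply: (close B3 B2 B5) => //=.
  by apply/and5P; split=> //; rewrite Lsym.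
(* The edges to [z] and to block [j + m.+1] exhaust the degree of [Y], so block [j] is crossed along
   [B3], [B2], [B5]. *)
have Tn t' : ~~ e (inl Y) (blk j t').
  apply/negP => L'; apply: (ham_three Lz L' Lt).
  rewrite /= !inE negb_or !zn ?leq_addr // !eqE // -[X in X == _]addn0.
  by rewrite eqn_add2l.
have [] := strand_cat (t1 := B3) (t2 := B2) (t3 := B5) jr Up Qp jpj isT.
have [a23 a25 oA oB] := ok_quietAB ok (Tn B0) (Tn B5) Aj Bj.
move=> Uq Qq; apply: (IHm j.+1 (p ++ [:: (i, blk j B3); (i, blk j B2); (i, blk j B5)])) => //.
- by rewrite addSnnS.
- by rewrite addSnnS.
- by rewrite cat_path Lp lastp; apply/and5P; split=> //; rewrite Lsym.
- by rewrite last_cat.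
- move=> j' t' jj' j'r; rewrite mem_cat negb_or jp ?(ltnW jj') //=.
  by rewrite !inE !eqE // !(gtn_eqF jj').
by rewrite mem_cat zp.
Qed.

Lemma Y_other v : L (i, inl Y) v -> exists2 w, w != v & L (i, inl Y) w.
Proof.
have [a [b [ab Lu]]] := ham_rel_two hamL (i, inl Y).
rewrite Lu => /orP[]/eqP->; [exists b | exists a] => //; last 1 first.
- by rewrite Lu /= eqxx.
- by rewrite eq_sym.
by rewrite Lu /= eqxx orbT.
Qed.

Lemma Y_nbr v : L (i, inl Y) v ->
  v = (i, inl One) \/ v = (i, inl Two) \/
  exists j t, [/\ j < r, t = B0 \/ t = B5 & v = (i, blk j t)].
Proof. by move/(ham_rel_adj hamL)/mem_nb_Y. Qed.

Lemma quiet_strand d : d <= r -> (forall j t, j < d -> ~~ e (inl Y) (blk j t)) ->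
  ~~ A 0 -> B 0 -> forall j, j <= d -> ~~ A j /\ B j.
Proof.
move=> dr quiet A0 B0'; elim=> // j IHj jd; have [Aj Bj] := IHj (ltnW jd).
by have [] := ok_quietB (site_ok (leq_trans jd dr)) (quiet _ _ jd) (quiet _ _ jd) Aj Bj.
Qed.

(** Otherwise the 5-cycle [B0] ... [B4] of the block would be a proper cycle inside [L]. *)
Lemma none_in j : j < r -> ~~ A j -> ~~ B j -> T j && U j.
Proof.
have eqE := (xpair_eqE, blk_eq, blk_hub, hub_blk, eqxx).
move=> jr Aj Bj; apply/idPn => TU.
have /and5P[a01 a12 a23 a34 a40] := ok_none (site_ok jr) TU Aj Bj.
apply: (@ham_no_cycle
  [:: (i, blk j B0); (i, blk j B1); (i, blk j B2); (i, blk j B3); (i, blk j B4)]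
  (i, inl Q)) => //; rewrite /= ?inE ?eqE //.
by apply/and5P; split=> //; rewrite andbT.
Qed.

(** Treats the case in which both used edges at [Y] lead into blocks, [d] being the earlier one. *)
Lemma two_blocks_absurd d t d' t' :
  ~~ e (inl Y) (inl One) -> ~~ A 0 -> B 0 ->
  d <= d' -> d' < r -> t = B0 \/ t = B5 -> t' = B0 \/ t' = B5 ->
  e (inl Y) (blk d t) -> e (inl Y) (blk d' t') -> (d == d') && (t == t') = false ->
  False.
Proof.
have eqE := (xpair_eqE, blk_eq, blk_hub, hub_blk, eqxx).
move=> y1 A0 B0' dd' d'r tE t'E Ld Ld' neq.
have dr : d < r := leq_ltn_trans dd' d'r.
have other j s : j < r -> e (inl Y) (blk j s) ->
    (j == d) && (s == t) || (j == d') && (s == t').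
  move=> jr Lj; apply/idPn; rewrite negb_or => /andP[n n'].
  by apply: (ham_three Lj Ld Ld'); rewrite /= !inE !negb_or !eqE //= n n' neq.
have quiet j s : j < d -> ~~ e (inl Y) (blk j s).
  move=> jd; apply/negP => /other; rewrite (ltn_trans jd) // => /(_ isT).
  by rewrite !ltn_eqF // (leq_trans jd).
have [Ad Bd] := quiet_strand (ltnW dr) quiet A0 B0' (leqnn d).
have ok := site_ok dr.
move: dd'; rewrite leq_eqVlt => /predU1P[dE|dd'].
  (* Both edges lead into the same block, and [Y], [B0], [B1], [B2], [B5] closes up. *)
  subst d'; have [Td Ud] : T d /\ U d.
    by case: tE t'E Ld Ld' neq => -> [] ->; rewrite eqxx.
  have [a01 a12 a25] := ok_B05 ok Td Ud Ad Bd.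
  apply: (@ham_no_cycle
    [:: (i, inl Y); (i, blk d B0); (i, blk d B1); (i, blk d B2); (i, blk d B5)]
    (i, inl Q)) => //; rewrite /= ?inE ?eqE //.
  by apply/and5P; split=> //; rewrite andbT Lsym.
have d1 : d.+1 + (d' - d.+1) = d' by rewrite subnKC.
have far j s s' : d.+1 <= j -> j < r -> (i, blk j s) != (i, blk d s').
  by move=> dj jr; rewrite !eqE // gtn_eqF.
(* From [B0] the strand passes [B1], [B2], [B5], and block [d] is left on both rails, so
   [strand_absurd] applies after it. *)
case: tE => tE; subst t.
  have Ud : ~~ U d.
    by apply/negP => /(other _ _ dr); rewrite eqxx (ltn_eqF dd').
  have [a01 a12 a25 oA oB] := ok_B0 ok Ld Ud Ad Bd.
  apply: (@strand_absurd (d' - d.+1) d.+1 t' (i, blk d B0)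
    [:: (i, blk d B0); (i, blk d B1); (i, blk d B2); (i, blk d B5)]);
    rewrite ?d1 //.
  - by apply/and5P; split.
  - by rewrite /= !inE !eqE.
  - by rewrite !inE !eqE.
  - by move=> j s dj jr; rewrite !inE !negb_or !far.
  by rewrite mem_head.
have Td : ~~ T d.
  by apply/negP => /(other _ _ dr); rewrite eqxx (ltn_eqF dd').
(* From [B5], either block [d] is left on both rails and [B5] alone is the strand, or it is left on
   neither. Then [none_in] gives [Y] two further edges, into block [d.+1], one too many. *)
have oAB := ok_B5 ok Td Ld Ad Bd.
have [oB|oB] := boolP (B d.+1).
  apply: (@strand_absurd (d' - d.+1) d.+1 t' (i, blk d B5) [:: (i, blk d B5)]);
    rewrite ?d1 ?oAB ?mem_head //.
  - by apply/andP; split.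
  - by rewrite /= !inE !eqE.
  - by rewrite !inE !eqE.
  by move=> j s dj jr; rewrite !inE !far.
have d1r : d.+1 < r := leq_ltn_trans dd' d'r.
have /andP[T1 U1] : T d.+1 && U d.+1 by apply: none_in => //; rewrite oAB.
move: (other _ _ d1r T1) (other _ _ d1r U1).
rewrite (gtn_eqF (ltnSn d)) /=.
by case/andP=> _ /eqP<-; rewrite andbF.
Qed.

(** The degree equations at [One], [Two] and [Q], with the triangle [Y], [One], [Two] excluded,
    leave four ways to use the edges of the hub. Three of them close a short cycle or overload
    [Y]. *)
Lemma copy_forced : L (i, inl Q) (prv i, srcB r) ->
  [/\ e (inl Q) (inl Two), e (inl Two) (inl Y), e (inl Y) (inl One) &
      (forall j, j <= r -> ~~ A j /\ B j) /\
      (forall j t, j < r -> ~~ e (inl Y) (blk j t))].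
Proof.
have eqE := (xpair_eqE, blk_eq, blk_hub, hub_blk, eqxx).
move=> f; have [] := hub_ok; rewrite f.
have es l l' : e l l' = e l' l by apply: Lsym.
have notri : ~~ [&& e (inl Y) (inl One), e (inl One) (inl Two) & e (inl Y) (inl Two)].
  apply/negP => /and3P[y1 x y2].
  apply: (@ham_no_cycle [:: (i, inl Y); (i, inl One); (i, inl Two)] (i, inl Q))
    => //; rewrite /= ?inE ?eqE //.
  by apply/and4P; split=> //; rewrite Lsym.
rewrite (es (inl Q)) (es (inl Two) (inl Y)).
have [y1|y1] := boolP (e (inl Y) (inl One));
  have [y2|y2] := boolP (e (inl Y) (inl Two)); move: notri;
  rewrite ?y1 ?y2 ?(negbTE y1) ?(negbTE y2) /= ?andbT;
  case x: (e (inl One) (inl Two)); case h: (e (inl Two) (inl Q));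
  case A0: (A 0); case B0': (B 0) => //= _ _ _ _.
(* The cycle runs [Q], [Two], [Y], [One], so no further edge at [Y] is used and the strand is forced
   through the strip. *)
- have quiet j t : j < r -> ~~ e (inl Y) (blk j t).
    move=> jr; apply/negP => Lj; apply: (ham_three Lj y1 y2).
    by rewrite /= !inE !eqE.
  split=> //; split=> // j jr; apply: (quiet_strand (leqnn r)) => //.
  by rewrite A0.
(* The cycle runs [Q], [Two], [One], [Y] and the second edge at [Y] leads into a block. No rail edge
   enters block 0, which therefore takes two edges from [Y] besides the one to [One]. *)
- have [w w1 Lw] := Y_other y1; exfalso.
  have [|[|[j [t [jr tE wE]]]]] := Y_nbr Lw.
  + by move/eqP; rewrite (negbTE w1).
  + by move=> wE; rewrite wE in Lw; rewrite -/(e _ _) (negbTE y2) in Lw.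
  have r0 : 0 < r := leq_ltn_trans (leq0n j) jr.
  have /andP[T0 U0] : T 0 && U 0 by apply: none_in; rewrite ?A0 ?B0'.
  by apply: (ham_three y1 T0 U0); rewrite /= !inE !eqE.
(* [Q] is left along the first rail, and [Y], [Two], [One] is a strand entering the second. *)
- have [w w1 Lw] := Y_other y2; exfalso.
  have [|[|[j [t [jr tE wE]]]]] := Y_nbr Lw.
  + by move=> wE; rewrite wE in Lw; rewrite -/(e _ _) (negbTE y1) in Lw.
  + by move/eqP; rewrite (negbTE w1).
  rewrite wE in Lw.
  apply: (@strand_absurd j 0 t (i, inl Two) [:: (i, inl Two); (i, inl One)]);
    rewrite ?mem_head //.
  + by apply/and3P; split=> //; rewrite Lsym.
  + by rewrite /= !inE !eqE.
  + by rewrite !inE !eqE.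
  by move=> j' t' _ j'r; rewrite !inE !eqE.
(* The cycle runs [Q], [Two], [One] into the strip, so both edges at [Y] lead into blocks. *)
have [a [b [ab Lu]]] := ham_rel_two hamL (i, inl Y); exfalso.
have La : L (i, inl Y) a by rewrite Lu /= eqxx.
have Lb : L (i, inl Y) b by rewrite Lu /= eqxx orbT.
have blkY v : L (i, inl Y) v ->
    exists j t, [/\ j < r, t = B0 \/ t = B5 & v = (i, blk j t)].
  move=> Lv; have [vE|[vE|//]] := Y_nbr Lv; rewrite vE in Lv.
    by rewrite -[L _ _]/(e (inl Y) (inl One)) (negbTE y1) in Lv.
  by rewrite -[L _ _]/(e (inl Y) (inl Two)) (negbTE y2) in Lv.
have [j [t [jr tE aE]]] := blkY a La; have [j' [t' [j'r t'E bE]]] := blkY b Lb.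
subst a b; move: ab; rewrite !eqE //= => /negbTE ab.
have A0n : ~~ A 0 by rewrite A0.
case/orP: (leq_total j j') => jj'.
  exact: (two_blocks_absurd y1 A0n B0' jj' j'r tE t'E La Lb ab).
apply: (two_blocks_absurd y1 A0n B0' jj' jr t'E tE Lb La).
by rewrite eq_sym (eq_sym t').
Qed.

Lemma copy_next_vert : L (i, inl Q) (prv i, srcB r) -> forall l, L (i, l) (next_vert (i, l)).
Proof.
move/copy_forced=> [qt ty y1 [AB quiet]] l; case: (locP l) => [h | j t jr].
  by case: h => //; case: (AB 0 (leq0n r)).
have [Aj Bj] := AB j (ltnW jr).
have [/and5P[a34 a40 a01 a12 a25] oB _] :=
  ok_quietB (site_ok jr) (quiet _ _ jr) (quiet _ _ jr) Aj Bj.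
by move: a34 a40 a01 a12 a25 oB; rewrite /ebl /B /srcB !blkE; case: t.
Qed.

End Copy.

(** * Forcing around the ring *)

Lemma ham_link i : L (i, srcB r) (nxt i, inl Q).
Proof.
have link_next j : L (j, srcB r) (nxt j, inl Q) ->
    L (nxt j, srcB r) (nxt (nxt j), inl Q).
  rewrite Lsym -{2}[j]nxtK => /copy_forced[_ _ _ [/(_ r (leqnn r))[_]]].
  by rewrite outB_last.
have [|no] := boolP [exists j, L (j, srcB r) (nxt j, inl Q)].
  case/existsP=> j Lj; rewrite -(iter_findex (nxt_conn j i)).
  by elim: findex => //= n; apply: link_next.
have [i' n1 n2] := third i.
(* With no used edge between consecutive copies, [L] leaves a copy only towards its mate, and never
   reaches the third copy [i']. *)
suff: (i' == i) || (i' == mate i) by rewrite (negbTE n1) (negbTE n2).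
apply: (@ham_rel_closed _ _ hamL (fun v => (v.1 == i) || (v.1 == mate i)) _ _
  (i', inl Q)).
  by exists (i, inl Q); rewrite eqxx.
move=> u v; cbv beta => Xu Luv; have := ham_rel_adj hamL Luv.
case/nb_out=> [->|[_ ->]|[uE vE]|[uE vE]] //=.
- by case/orP: Xu => /eqP->; rewrite ?mateK eqxx ?orbT.
- case/negP: no; apply/existsP; exists u.1; rewrite -vE -uE //.
case/negP: no; apply/existsP; exists (prv u.1).
by rewrite prvK Lsym -vE -uE.
Qed.

Lemma ham_next_vert v : L v (next_vert v).
Proof.
case: v => i l; apply: copy_next_vert; rewrite Lsym -{2}[i]prvK.
exact: ham_link.
Qed.

End Ham.

Lemma gr_uniquely_hamiltonian : inhabited I -> uniquely_hamiltonian gr.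
Proof.
case=> i0; pose c : seq gr := orbit next_vert ((i0, inl Q) : vert).
have cG : c =i gr by move=> v; rewrite -fconnect_orbit next_vert_conn.
have Uc : uniq c := orbit_uniq _ _.
have fc : fcycle next_vert c := cycle_orbit (can_inj next_vertK) _.
have next_c (v : gr) : next c v = next_vert v.
  by apply/esym/eqP/(next_cycle fc); rewrite cG.
have c3 : 2 < size c.
  have s3 : uniq [:: (i0, inl Q); (i0, inl Y); (i0, inl One) : gr].
    by rewrite /= !inE !xpair_eqE !eqxx.
  by apply: (uniq_leq_size s3) => v _; rewrite cG.
have Ac : cycle (@adj gr) c.
  by apply: (sub_cycle _ fc) => u v /eqP<-; apply: next_vert_adj.
exists (cycle_edges c); split; first by exists c.
move=> _ [c' [c'3 Uc' Ac' c'G ->]].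
have hamc := cycle_ham_rel c3 Uc Ac cG.
have hamc' := cycle_ham_rel c'3 Uc' Ac' c'G.
have sub u v : cycle_rel c u v -> cycle_rel c' u v.
  case/orP=> /eqP->; rewrite next_c; last rewrite (ham_rel_sym hamc').
    exact: ham_next_vert.
  exact: ham_next_vert.
(* Both relations are 2-regular, so inclusion of one in the other gives equality. *)
have eqc u v : cycle_rel c u v = cycle_rel c' u v.
  apply/idP/idP => [|Luv]; first exact: sub.
  have [a [b [ab cu]]] := ham_rel_two hamc u.
  have La : cycle_rel c u a by rewrite cu /= eqxx.
  have Lb : cycle_rel c u b by rewrite cu /= eqxx orbT.
  apply/idPn; rewrite cu negb_or => /andP[va vb].
  apply: (ham_three hamc' Luv (sub _ _ La) (sub _ _ Lb)).
  by rewrite /= !inE negb_or va vb ab.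
apply/setP => E; apply/(mem_cycle_edges _ cG)/(mem_cycle_edges _ c'G);
  by case=> u [v [Luv ->]]; exists u, v; rewrite ?eqc // -?eqc.
Qed.


(** * Connectivity *)

Local Ltac adj_tac :=
  rewrite /= /nb_adj; repeat rewrite ?nb_blk ?outA_blk ?outB_blk //;
  rewrite ?inE ?eqxx ?orbT.

Local Ltac adj_tac_out :=
  adj_tac; rewrite ?outA_blk ?outB_blk //; rewrite ?eqxx ?orbT.

Hypothesis nxt_neq : forall j, nxt j != j.

(** * Walks after the deletion of a set of vertices *)

Section Deletion.

Variable S : {set gr}.

Local Notation "u ~~> v" := (connect (@del_adj gr S) u v) (at level 70).

Let free (p : seq gr) := all (fun v => v \notin S) p.

Lemma del_sym : connect_sym (@del_adj gr S).
Proof.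
apply: sym_connect_sym => u v; rewrite /del_adj /= nb_adj_sym.
by rewrite !andbA (andbC (u \notin S)).
Qed.

Lemma del_walk u p : u \notin S -> free p -> path nb_adj u p -> u ~~> last u p.
Proof.
elim: p u => [|v p IHp] u /= uS; first by [].
move=> /andP[vS fp] /andP[uv up]; apply: connect_trans (IHp v vS fp up).
by apply: connect1; rewrite /del_adj /= uS vS.
Qed.

Lemma free_last u p : u \notin S -> free p -> last u p \notin S.
Proof. by elim: p u => //= v p IHp u _ /andP[vS]; apply: IHp. Qed.

Lemma del_three u v w : #|S| <= 2 ->
  u \in S -> v \in S -> w \in S -> uniq [:: u; v; w] -> False.
Proof.
move=> S2 uS vS wS Us; suff: 2 < #|S| by rewrite ltnNge S2.
rewrite -[3]/(size [:: u; v; w]) -(card_uniqP Us); apply: subset_leq_card.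
by apply/subsetP => x; rewrite !inE => /or3P[]/eqP->.
Qed.

(** * Routes inside one copy *)

Section Copy.

Variable i : I.

Lemma copy_intact : (forall l, (i, l) \notin S) ->
  forall l, (i, l) ~~> (i, inl Y).
Proof.
move=> iS l; have walk (p : seq loc) : path nb_adj (i, l) [seq (i, m) | m <- p] ->
    last l p = inl Y -> (i, l) ~~> (i, inl Y).
  move=> lp <-; rewrite -(last_map (pair i)); apply: del_walk => //.
  by apply/allP => _ /mapP[m _ ->].
case: (locP l) walk => [[]|j [] jr] walk.
- by apply: (walk [::]).
- by apply: (walk [:: inl Y]); adj_tac.
- by apply: (walk [:: inl Y]); adj_tac.
- by apply: (walk [:: inl Two; inl Y]); adj_tac.
- by apply: (walk [:: inl Y]); adj_tac.
- by apply: (walk [:: blk j B0; inl Y]); adj_tac.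
- by apply: (walk [:: blk j B5; inl Y]); adj_tac.
- by apply: (walk [:: blk j B4; blk j B0; inl Y]); adj_tac.
- by apply: (walk [:: blk j B0; inl Y]); adj_tac.
by apply: (walk [:: inl Y]); adj_tac.
Qed.


Let fr (p : seq loc) := all (fun m => (i, m) \notin S) p.

Lemma copy_walk (p : seq loc) l : (i, l) \notin S -> fr p ->
  path nb_adj (i, l) [seq (i, m) | m <- p] -> (i, l) ~~> (i, last l p).
Proof.
move=> lS fp lp; rewrite -(last_map (pair i)); apply: del_walk => //.
by rewrite /free all_map.
Qed.

Lemma frPn p : ~~ fr p -> exists2 m, m \in p & (i, m) \in S.
Proof. by case/allPn=> m mp; rewrite negbK; exists m. Qed.

(** A single deleted vertex cannot block two disjoint routes. *)
Lemma fan2 p q : (forall l l', (i, l) \in S -> (i, l') \in S -> l = l') ->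
  uniq (p ++ q) -> fr p \/ fr q.
Proof.
move=> one Upq; have [fp|/frPn[x xp xS]] := boolP (fr p); first by left.
have [fq|/frPn[y yq yS]] := boolP (fr q); first by right.
move: Upq; rewrite cat_uniq => /and3P[_ /hasPn/(_ y yq)].
by rewrite -(one _ _ xS yS) /= xp.
Qed.

Lemma fan3 p q s : #|S| <= 2 -> uniq (p ++ q ++ s) -> [\/ fr p, fr q | fr s].
Proof.
move=> S2 Upqs; have [fp|/frPn[x xp xS]] := boolP (fr p); first by constructor 1.
have [fq|/frPn[y yq yS]] := boolP (fr q); first by constructor 2.
have [fs|/frPn[z zs zS]] := boolP (fr s); first by constructor 3.
case: (del_three S2 xS yS zS); have Uxyz : uniq [:: x; y; z].
  apply: subseq_uniq Upqs; rewrite -[_ :: _]/([:: x] ++ [:: y] ++ [:: z]).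
  by do 2?apply: cat_subseq; rewrite sub1seq.
by rewrite -(map_inj_uniq (f := pair i)) // in Uxyz => ? ? [].
Qed.

(** [w] takes one of the two deletions and lies on neither route, so the other deletion blocks at
    most one of them. *)
Lemma fan2_in w p q : #|S| <= 2 -> (i, w) \in S -> w \notin p -> w \notin q ->
  (forall m, m \in p -> m \notin q) -> fr p \/ fr q.
Proof.
move=> S2 wS wp wq pq; have [fp|/frPn[x xp xS]] := boolP (fr p); first by left.
have [fq|/frPn[y yq yS]] := boolP (fr q); first by right.
have xy : x != y by apply: contraNneq (pq x xp) => ->.
case: (del_three S2 wS xS yS); rewrite /= !inE !xpair_eqE !eqxx /= negb_or xy.
by rewrite !(eq_sym w) (memPn wp _ xp) (memPn wq _ yq).
Qed.

Hypothesis r_gt0 : 0 < r.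

Let eqSn j : (j.+1 == j) = false.
Proof. exact: gtn_eqF (ltnSn j). Qed.

Let eqnS j : (j == j.+1) = false.
Proof. exact: ltn_eqF (ltnSn j). Qed.

Let eqE := (blk_eq, blk_hub, hub_blk, eqSn, eqnS, eqxx).

Local Ltac uniq_tac := rewrite /= ?inE; rewrite ?eqE //.

(** If [Y] is deleted, the rest of the copy survives and leads back along [B5], [B2], [B3] to [One].
    Otherwise each other surviving vertex is adjacent to [Y] or has two disjoint routes to it. *)
Lemma copy_conn : (forall l l', (i, l) \in S -> (i, l') \in S -> l = l') ->
  forall l l', (i, l) \notin S -> (i, l') \notin S -> (i, l) ~~> (i, l').
Proof.
move=> one; suff [c cC] : exists c, forall l, (i, l) \notin S -> (i, l) ~~> (i, c).
  move=> l l' lS l'S; apply: connect_trans (cC l lS) _.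
  by rewrite del_sym; apply: cC.
have [YS|YS] := boolP ((i, inl Y) \in S).
  have nS l : l != inl Y -> (i, l) \notin S.
    by apply: contraNN => lS; apply/eqP/one.
  exists (inl One) => l lS; have walk p : path nb_adj (i, l) [seq (i, m) | m <- p] ->
      inl Y \notin p -> (i, l) ~~> (i, last l p).
    move=> lp Yp; apply: copy_walk => //; apply/allP => m mp; apply: nS.
    by apply: contraNneq Yp => <-.
  have srcB_one j : j <= r -> (i, srcB j) ~~> (i, inl One).
    elim: j => // j IHj jr; apply: connect_trans (IHj (ltnW jr)).
    apply: (@copy_walk [:: blk j B2; blk j B3; srcB j]); last by adj_tac.
      by rewrite nS // eqE.
    by rewrite /fr /= !nS ?eqE //; case: j {IHj} jr => // j jr; rewrite eqE // ltnW.
  have toB j p : j < r -> last l p = srcB j -> inl Y \notin p ->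
      path nb_adj (i, l) [seq (i, m) | m <- p] -> (i, l) ~~> (i, inl One).
    move=> jr lB Yp lp; apply: connect_trans (srcB_one j (ltnW jr)).
    by rewrite -lB; apply: walk.
  have YB j : j < r -> (inl Y == srcB j) = false.
    by case: j => // j jr; rewrite eqE // ltnW.
  case: (locP l) lS walk toB => [[]|j [] jr] lS walk toB.
  - by rewrite YS in lS.
  - by [].
  - by apply: (walk [:: inl One]); adj_tac.
  - by apply: (walk [:: inl Two; inl One]); adj_tac.
  - apply: (@toB j [:: blk j B4; blk j B3; srcB j]) => //; last by adj_tac.
    by rewrite !inE YB // !eqE.
  - apply: (@toB j [:: blk j B2; blk j B3; srcB j]) => //; last by adj_tac.
    by rewrite !inE YB // !eqE.
  - apply: (@toB j [:: blk j B3; srcB j]) => //; last by adj_tac.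
    by rewrite !inE YB // !eqE.
  - apply: (@toB j [:: srcB j]) => //; last by adj_tac.
    by rewrite !inE YB // !eqE.
  - apply: (@toB j [:: blk j B3; srcB j]) => //; last by adj_tac.
    by rewrite !inE YB // !eqE.
  exact: (srcB_one j.+1).
exists (inl Y) => l lS.
have walk p : fr p -> path nb_adj (i, l) [seq (i, m) | m <- p ++ [:: inl Y]] ->
    (i, l) ~~> (i, inl Y).
  move=> fp lp; have := copy_walk lS _ lp; rewrite last_cat; apply.
  by rewrite /fr all_cat -/(fr p) fp /= YS.
case: (locP l) lS walk => [[]|j [] jr] lS walk //.
- by apply: (walk [::]); adj_tac.
- by apply: (walk [::]); adj_tac.
(* The second route from [Q] runs through block 0, which exists because [0 < r]. *)
- have [] := @fan2 [:: inl Two] [:: blk 0 B1; blk 0 B0] one; first by uniq_tac.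
    by move=> fp; apply: (walk _ fp); adj_tac.
  by move=> fp; apply: (walk _ fp); adj_tac_out.
- by apply: (walk [::]); adj_tac.
- have [] := @fan2 [:: blk j B0] [:: blk j B2; blk j B5] one; first by uniq_tac.
    by move=> fp; apply: (walk _ fp); adj_tac.
  by move=> fp; apply: (walk _ fp); adj_tac.
- have [] := @fan2 [:: blk j B5] [:: blk j B1; blk j B0] one; first by uniq_tac.
    by move=> fp; apply: (walk _ fp); adj_tac.
  by move=> fp; apply: (walk _ fp); adj_tac.
- have [] := @fan2 [:: blk j B2; blk j B5] [:: blk j B4; blk j B0] one; first by uniq_tac.
    by move=> fp; apply: (walk _ fp); adj_tac.
  by move=> fp; apply: (walk _ fp); adj_tac.
- have [] := @fan2 [:: blk j B0] [:: blk j B3; blk j B2; blk j B5] one; first by uniq_tac.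
    by move=> fp; apply: (walk _ fp); adj_tac.
  by move=> fp; apply: (walk _ fp); adj_tac.
by apply: (walk [::]); adj_tac.
Qed.

Let last_r : r.-1 < r.
Proof. by rewrite prednK. Qed.

Let srcA_r : srcA r = blk r.-1 B4.
Proof. by rewrite (congr1 srcA (esym (prednK r_gt0))). Qed.

Let srcB_r : srcB r = blk r.-1 B5.
Proof. by rewrite (congr1 srcB (esym (prednK r_gt0))). Qed.

(** The listed vertices are the ports of the copy, its only vertices with edges to other copies. *)
Definition escapes l := exists m,
  [/\ m \in [:: inl Q; srcA r; srcB r], (i, m) \notin S & (i, l) ~~> (i, m)].

Lemma escapes_port l : l \in [:: inl Q; srcA r; srcB r] -> (i, l) \notin S ->
  escapes l.
Proof. by move=> lP lS; exists l. Qed.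

Lemma escapes_walk p l : (i, l) \notin S -> fr p ->
  path nb_adj (i, l) [seq (i, m) | m <- p] ->
  last l p \in [:: inl Q; srcA r; srcB r] -> escapes l.
Proof.
move=> lS fp lp lP; exists (last l p); split=> //; last exact: copy_walk.
by have := free_last lS (p := [seq (i, m) | m <- p]); rewrite last_map; apply;
  rewrite /free all_map.
Qed.

Lemma escapes_trans l m : (i, l) ~~> (i, m) -> escapes m -> escapes l.
Proof.
by move=> lm [n [nP nS mn]]; exists n; split=> //; apply: connect_trans mn.
Qed.

(** [Y] has disjoint routes to the three ports. Any other surviving vertex is a port, is adjacent to
    [Y], or has three disjoint routes leading to [Y] or a port, and two deletions cannot block three
    routes. *)
Lemma escape_hub : #|S| <= 2 -> (i, inl Y) \notin S ->
  forall l, (i, l) \notin S -> escapes l.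
Proof.
move=> S2 YS.
have Yesc : escapes (inl Y).
  have Yz t : t = B0 \/ t = B5 -> nb_adj (i, inl Y) (i, blk r.-1 t).
    by move=> tE; apply/mem_nb_Y; right; right; exists r.-1, t.
  have [] := @fan3 [:: inl Two; inl Q] [:: blk r.-1 B5] [:: blk r.-1 B0; blk r.-1 B4] S2.
  - by uniq_tac.
  - by move=> fp; apply: (escapes_walk YS fp); [adj_tac | rewrite !inE eqxx].
  - move=> fp; apply: (escapes_walk YS fp); first by rewrite /= Yz //; right.
    by rewrite /= !inE srcB_r eqxx !orbT.
  move=> fp; apply: (escapes_walk YS fp); last by rewrite /= !inE srcA_r eqxx !orbT.
  by rewrite /= Yz ?andbT; [adj_tac | left].
move=> l lS; have walk p : fr p -> path nb_adj (i, l) [seq (i, m) | m <- p ++ [:: inl Y]] ->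
    escapes l.
  move=> fp lp; apply: escapes_trans Yesc.
  have := copy_walk lS _ lp; rewrite last_cat; apply.
  by rewrite /fr all_cat -/(fr p) fp /= YS.
have srcB_Y j : j <= r -> (i, inl Y) \in nb (i, srcB j).
  by case: j => [|j] jr; adj_tac.
case: (locP l) lS walk => [[]|j [] jr] lS walk //.
- by apply: (walk [::]); adj_tac.
- by apply: (walk [::]); adj_tac.
- by apply: escapes_port; rewrite ?inE ?eqxx.
- by apply: (walk [::]); adj_tac.
(* The third route goes back along the first rail: to [Q] from block 0, otherwise to [Y] through the
   preceding block. *)
- have [] := @fan3 [:: blk j B0] [:: blk j B2; blk j B5]
    (if j is j'.+1 then [:: blk j' B4; blk j' B0] else [:: inl Q]) S2.
  + by case: j jr {lS walk} => [|j] jr; have jr' := ltnW jr; uniq_tac.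
  + by move=> fp; apply: (walk _ fp); adj_tac.
  + by move=> fp; apply: (walk _ fp); adj_tac.
  case: j jr lS walk => [|j] jr lS walk fp.
    by apply: (escapes_walk lS fp); [adj_tac | rewrite !inE eqxx].
  by have jr' := ltnW jr; apply: (walk _ fp); adj_tac.
- have [] := @fan3 [:: blk j B5] [:: blk j B1; blk j B0] [:: blk j B3; srcB j] S2.
  + by case: j jr {lS walk} => [|j] jr; have jr' := ltnW jr; uniq_tac.
  + by move=> fp; apply: (walk _ fp); adj_tac.
  + by move=> fp; apply: (walk _ fp); adj_tac.
  by move=> fp; apply: (walk _ fp); adj_tac; rewrite srcB_Y // ltnW.
- have [] := @fan3 [:: blk j B2; blk j B5] [:: blk j B4; blk j B0] [:: srcB j] S2.
  + by case: j jr {lS walk} => [|j] jr; have jr' := ltnW jr; uniq_tac.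
  + by move=> fp; apply: (walk _ fp); adj_tac.
  + by move=> fp; apply: (walk _ fp); adj_tac.
  by move=> fp; apply: (walk _ fp); adj_tac; rewrite srcB_Y // ltnW.
- have [jE|jr'] : j.+1 = r \/ j.+1 < r by move: jr; rewrite leq_eqVlt => /predU1P.
    by apply: escapes_port; rewrite // -(congr1 srcA jE) !inE eqxx !orbT.
  have [] := @fan3 [:: blk j B0] [:: blk j B3; blk j B2; blk j B5]
    [:: blk j.+1 B1; blk j.+1 B0] S2.
  + by uniq_tac.
  + by move=> fp; apply: (walk _ fp); adj_tac.
  + by move=> fp; apply: (walk _ fp); adj_tac.
  by move=> fp; apply: (walk _ fp); adj_tac_out.
by apply: (walk [::]); adj_tac.
Qed.

(* Routes along the strand of sites [B3, B2, B5]: from the source of block [j]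
   back to [Q], and from block [j] forward through [n] blocks. *)
Fixpoint back j : seq loc :=
  if j is j'.+1 then [:: blk j' B5, blk j' B2, blk j' B3 & back j']
  else [:: inl One; inl Two; inl Q].

Fixpoint forth n j : seq loc :=
  if n is n'.+1 then [:: blk j B3, blk j B2, blk j B5 & forth n' j.+1] else [::].

Lemma back_path m j : j <= r -> nb_adj (i, m) (i, srcB j) ->
  path nb_adj (i, m) [seq (i, l) | l <- back j].
Proof.
elim: j m => [|j IHj] m jr; first by move=> mB; rewrite /= mB; adj_tac.
move=> mB; rewrite /= mB /=; apply/and3P; split; try by adj_tac.
by apply: (IHj _ (ltnW jr)); adj_tac.
Qed.

Lemma last_back m j : last m (back j) = inl Q.
Proof. by elim: j m => //= j IHj m; apply: IHj. Qed.

Lemma forth_path n j : j + n = r -> path nb_adj (i, srcB j) [seq (i, l) | l <- forth n j].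
Proof.
elim: n j => // n IHn j jnr; have jr : j < r by rewrite -jnr -addn1 leq_add2l.
rewrite /=; apply/and4P; split; try by adj_tac.
  by rewrite -(outB_blk i jr); apply: outB_mem; apply: ltnW.
by apply: (IHn j.+1); rewrite addSnnS.
Qed.

Lemma last_forth n j : j + n = r -> last (srcB j) (forth n j) = srcB r.
Proof.
by elim: n j => [|n IHn] j; [rewrite addn0 => /(congr1 srcB) | rewrite -addSnnS => /IHn].
Qed.

(** The shift by one puts the hub before block 0. Then [back j] stays at positions up to [j] and
    [forth n j] beyond [j], which separates such routes. *)
Definition pos (l : loc) : nat := if l is inr (o, _) then o.+1 else 0.

Lemma pos_blk j t : j < r -> pos (blk j t) = j.+1.
Proof. by move=> jr; rewrite blkE. Qed.

Lemma pos_back j : j <= r -> all (fun l => (pos l <= j) && (l != inl Y)) (back j).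
Proof.
elim: j => // j IHj jr /=; rewrite !pos_blk // leqnn !eqE //=.
by apply: sub_all (IHj (ltnW jr)) => l /andP[/leqW->].
Qed.

Lemma pos_forth n j : j + n = r -> all (fun l => j < pos l) (forth n j).
Proof.
elim: n j => // n IHn j jnr; have jr : j < r by rewrite -jnr -addn1 leq_add2l.
rewrite /= !pos_blk // leqnn /=; rewrite -addSnnS in jnr.
by apply: sub_all (IHn _ jnr) => l /ltnW.
Qed.

(* With [Y] deleted, one of two disjoint routes from [l], backward and forward,
   survives. *)
Lemma escape_fan l a b j n k : #|S| <= 2 -> (i, inl Y) \in S -> (i, l) \notin S ->
  j < k -> j <= r -> k + n = r ->
  all (fun m => (pos m <= k) && (m != inl Y)) a -> all (fun m => j < pos m) b ->
  ~~ has (mem a) b ->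
  path nb_adj (i, l) [seq (i, m) | m <- a ++ back j] ->
  path nb_adj (i, l) [seq (i, m) | m <- b] -> last l b = srcB k ->
  escapes l.
Proof.
move=> S2 YS lS jk jr knr ak bj ab pa pb lb.
have bk := pos_back jr; have fk := pos_forth knr.
have [] := @fan2_in (inl Y) (a ++ back j) (b ++ forth n k) S2 YS.
- rewrite mem_cat negb_or; apply/andP; split.
    by apply/negP => /(allP ak); rewrite eqxx andbF.
  by apply/negP => /(allP bk); rewrite eqxx andbF.
- by rewrite mem_cat negb_or; apply/andP; split;
    [apply/negP => /(allP bj) | apply/negP => /(allP fk)].
- move=> m; rewrite !mem_cat negb_or => /orP[ma|mb]; apply/andP; split.
  + by apply: contraNN ab => mb; apply/hasP; exists m.
  + by have /andP[mk _] := allP ak m ma; apply/negP => /(allP fk); rewrite ltnNge mk.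
  + by have /andP[mj _] := allP bk m mb; apply/negP => /(allP bj); rewrite ltnNge mj.
  have /andP[mj _] := allP bk m mb; apply/negP => /(allP fk).
  by rewrite ltnNge (leq_trans mj (ltnW jk)).
- by move=> fp; apply: (escapes_walk lS fp) => //; rewrite last_cat last_back inE eqxx.
move=> fp; apply: (escapes_walk lS fp).
  by rewrite map_cat cat_path pb last_map lb forth_path.
by rewrite last_cat lb last_forth // !inE eqxx !orbT.
Qed.

Lemma escape_nohub : #|S| <= 2 -> (i, inl Y) \in S ->
  forall l, (i, l) \notin S -> escapes l.
Proof.
move=> S2 YS l; have r0 : 0 + r = r by [].
have f0 := forth_path r0; have l0 := last_forth r0; have p0 := pos_forth r0.
have sub j : j < r -> j.+1 + (r - j.+1) = r by move=> jr; rewrite subnKC.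
case: (locP l) => [h|j t jr] lS.
  have fan p q : all (fun m => pos m == 0) p -> inl Y \notin p ->
      ~~ has (mem p) q -> inl Y \notin q -> all (fun m => pos m == 0) q ->
      path nb_adj (i, inl h) [seq (i, m) | m <- p] -> last (inl h) p = inl Q ->
      path nb_adj (i, inl h) [seq (i, m) | m <- q] -> last (inl h) q = inl One ->
      escapes (inl h).
    move=> p00 Yp pq Yq q00 pp lp qq lq.
    have [] := @fan2_in (inl Y) p (q ++ forth r 0) S2 YS Yp.
    - by rewrite mem_cat negb_or Yq; apply/negP => /(allP p0).
    - move=> m mp; rewrite mem_cat negb_or; apply/andP; split.
        by apply: contraNN pq => mq; apply/hasP; exists m.
      by apply/negP => /(allP p0); rewrite (eqP (allP p00 m mp)).
    - by move=> fp; apply: (escapes_walk lS fp) => //; rewrite lp inE eqxx.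
    move=> fp; apply: (escapes_walk lS fp).
      by rewrite map_cat cat_path qq last_map lq.
    by rewrite last_cat lq (last_forth r0) !inE eqxx !orbT.
  case: h lS fan => lS fan.
  - by rewrite YS in lS.
  - by apply: (fan [:: inl Two; inl Q] [::]); adj_tac.
  - by apply: (fan [:: inl Q] [:: inl One]); adj_tac.
  by apply: escapes_port; rewrite ?inE ?eqxx.
have js := sub j jr; have posE s : pos (blk j s) = j.+1 by apply: pos_blk.
have jB : nb_adj (i, blk j B3) (i, srcB j) by adj_tac.
have jb m : nb_adj (i, m) (i, srcB j) -> path nb_adj (i, m) [seq (i, l') | l' <- back j].
  by apply: back_path; rewrite ltnW.
have bk := back_path (ltnW jr) jB.
(* Inside block [j], [a] leads to [B3], from where the route goes back to [Q], and [b] to [B5], from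
   where it goes forth. *)
have fan a b : all (fun m => (pos m <= j.+1) && (m != inl Y)) a ->
    all (fun m => j < pos m) b -> ~~ has (mem a) b ->
    path nb_adj (i, blk j t) [seq (i, m) | m <- a] -> last (blk j t) a = blk j B3 ->
    path nb_adj (i, blk j t) [seq (i, m) | m <- b] -> last (blk j t) b = blk j B5 ->
    escapes (blk j t).
  move=> ha hb hab pa la pb lb.
  apply: (@escape_fan _ a b j (r - j.+1) j.+1) => //; first exact: ltnW.
  by rewrite map_cat cat_path pa last_map la.
case: t lS fan => lS fan.
- by apply: (fan [:: blk j B4; blk j B3] [:: blk j B1; blk j B2; blk j B5]);
    rewrite /= ?inE ?posE ?eqE ?leqnn //; adj_tac.
- by apply: (fan [:: blk j B0; blk j B4; blk j B3] [:: blk j B2; blk j B5]);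
    rewrite /= ?inE ?posE ?eqE ?leqnn //; adj_tac.
- by apply: (fan [:: blk j B3] [:: blk j B5]);
    rewrite /= ?inE ?posE ?eqE ?leqnn //; adj_tac.
- by apply: (fan [::] [:: blk j B2; blk j B5]);
    rewrite /= ?inE ?posE ?eqE ?leqnn //; adj_tac.
- by apply: (fan [:: blk j B3] [:: blk j B0; blk j B1; blk j B2; blk j B5]);
    rewrite /= ?inE ?posE ?eqE ?leqnn //; adj_tac.
by apply: (fan [:: blk j B2; blk j B3] [::]);
  rewrite /= ?inE ?posE ?eqE ?leqnn //; adj_tac.
Qed.

Lemma escape : #|S| <= 2 -> forall l, (i, l) \notin S -> escapes l.
Proof.
by move=> S2; have [YS|YS] := boolP ((i, inl Y) \in S);
  [apply: escape_nohub | apply: escape_hub].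
Qed.

End Copy.

(** With an empty strip [One] and [Q] are the ports, and [Y] and [Two] have disjoint routes to
    both. *)
Lemma escape0 i : r = 0 -> #|S| <= 1 ->
  forall l, (i, l) \notin S -> escapes i l.
Proof.
move=> r0 S1; have B0 : srcB r = inl One by rewrite (congr1 srcB r0).
have one l l' : (i, l) \in S -> (i, l') \in S -> l = l'.
  by move=> lS l'S; have [] := card_le1_eqP S1 _ _ lS l'S.
have portB : inl One \in [:: inl Q; srcA r; srcB r] by rewrite B0 !inE eqxx !orbT.
move=> l; case: (locP l) => [h|j t]; last by rewrite {1}r0.
have two p q : uniq (p ++ q) ->
    path nb_adj (i, inl h) [seq (i, m) | m <- p] ->
    path nb_adj (i, inl h) [seq (i, m) | m <- q] ->
    last (inl h) p = inl One -> last (inl h) q = inl Q ->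
    (i, inl h) \notin S -> escapes i (inl h).
  move=> Upq pp pq lp lq lS; have [fp|fq] := fan2 one Upq.
    by apply: (escapes_walk lS fp); rewrite ?lp.
  by apply: (escapes_walk lS fq); rewrite ?lq // !inE eqxx.
case: h two => two lS.
- by apply: (two [:: inl One] [:: inl Two; inl Q]); adj_tac.
- exact: escapes_port.
- by apply: (two [:: inl One] [:: inl Q]); adj_tac.
by apply: escapes_port; rewrite ?inE ?eqxx.
Qed.

(** * Routes between copies *)

Lemma link_adj j : nb_adj (j, srcB r) (nxt j, inl Q).
Proof. by rewrite -(@outB_last j r) // /nb_adj outB_mem. Qed.

Lemma chord_adj j : nb_adj (j, srcA r) (mate j, srcA r).
Proof. by rewrite -(@outA_last j r) // /nb_adj outA_mem. Qed.

Lemma iter_nxt_inj j k m : k < m -> m < order nxt j -> iter k nxt j != iter m nxt j.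
Proof.
move=> km mo; apply/eqP => /(congr1 (findex nxt j)).
by rewrite !findex_iter ?(ltn_trans km) // => kE; rewrite kE ltnn in km.
Qed.

(** The other copies are intact and stay connected along the ring from [nxt i] onwards; what
    survives in copy [i] joins them through a port. *)
Lemma del_same i : (forall u, u \in S -> u.1 = i) ->
  (forall l, (i, l) \notin S -> escapes i l) ->
  forall u v : gr, u \notin S -> v \notin S -> u ~~> v.
Proof.
move=> Si esc; have other j l : j != i -> (j, l) \notin S.
  by apply: contraNN => /Si /= ->.
have hubY j l : j != i -> (j, l) ~~> (j, inl Y).
  by move=> ji; apply: copy_intact => m; apply: other.
have step j : j != i -> nxt j != i -> (j, inl Y) ~~> (nxt j, inl Y).
  move=> ji ni; apply: connect_trans (hubY _ (inl Q) ni).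
  apply: (@connect_trans _ _ (j, srcB r)); first by rewrite del_sym hubY.
  by apply: connect1; rewrite /del_adj /= !other // link_adj.
have all_Y k : k.+1 < order nxt i ->
    (nxt i, inl Y) ~~> (iter k.+1 nxt i, inl Y).
  elim: k => // k IHk ko; apply: connect_trans (IHk (ltnW ko)) _.
  by apply: step; rewrite -?iterS eq_sym (@iter_nxt_inj i 0) // ltnW.
have toY j l : j != i -> (nxt i, inl Y) ~~> (j, l).
  move=> ji; apply: (@connect_trans _ _ (j, inl Y)); last by rewrite del_sym hubY.
  have jE := iter_findex (nxt_conn i j).
  have := findex_max (nxt_conn i j); case: (findex nxt i j) jE => [|k] jE ko.
    by rewrite -jE /= eqxx in ji.
  by rewrite -jE; apply: all_Y.
have prv_neq : prv i != i by rewrite -(can_eq nxtK) prvK eq_sym nxt_neq.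
have toY' (u : gr) : u \notin S -> (nxt i, inl Y) ~~> u.
  case: u => j l; have [->|ji _] := eqVneq j i; last exact: toY.
  move=> /esc[m [mP mS lm]]; rewrite del_sym; apply: connect_trans lm _.
  (* Every port has a neighbour in another copy, hence outside [S]. *)
  suff [i' [m' [i'i mm']]] : exists i' m', i' != i /\ nb_adj (i, m) (i', m').
    rewrite del_sym; apply: connect_trans (toY _ m' i'i) _.
    by rewrite del_sym; apply: connect1; rewrite /del_adj /= mS other.
  move: mP; rewrite !inE => /or3P[]/eqP->.
  - exists (prv i), (srcB r); split=> //.
    by rewrite nb_adj_sym -{2}[i]prvK link_adj.
  - by exists (mate i), (srcA r); rewrite mate_neq chord_adj.
  by exists (nxt i), (inl Q); rewrite nxt_neq link_adj.
by move=> u v uS vS; apply: connect_trans (toY' _ vS); rewrite del_sym toY'.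
Qed.

(** * Two vertices deleted from different copies *)

Section Spread.

Hypothesis r_gt0 : 0 < r.
Hypothesis mate_nxt : forall j, mate (nxt j) = nxt (mate j).
Hypothesis S2 : #|S| <= 2.
Variables w1 w2 : gr.
Hypotheses (w1S : w1 \in S) (w2S : w2 \in S) (w12 : w1.1 != w2.1).

Let one j l l' : (j, l) \in S -> (j, l') \in S -> l = l'.
Proof.
move=> lS l'S; apply/eqP/idPn => ll'.
have [w [wS wj]] : exists w, w \in S /\ w.1 != j.
  by have [<-|] := eqVneq w1.1 j; [exists w2; rewrite eq_sym | exists w1].
case: (del_three S2 wS lS l'S); case: w wj {wS} => j' m /= jj'.
by rewrite !inE !xpair_eqE (negbTE jj') eqxx /= ll'.
Qed.

(** Each copy loses at most one vertex and stays connected, so connection can be studied between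
    whole copies. *)
Let cc j j' := forall l l', (j, l) \notin S -> (j', l') \notin S ->
  (j, l) ~~> (j', l').

Let cc_refl j : cc j j.
Proof. by apply: copy_conn => // l l'; apply: one. Qed.

Let cc_sym j j' : cc j j' -> cc j' j.
Proof. by move=> jj' l l' lS l'S; rewrite del_sym; apply: jj'. Qed.

Let cc_trans j j' j'' : cc j j' -> cc j' j'' -> cc j j''.
Proof.
move=> jj' j'j'' l l'' lS l''S.
have [m mS] : exists m, (j', m) \notin S.
  have [oS|] := boolP ((j', inl One) \in S); last by exists (inl One).
  by exists (inl Two); apply/negP => /(one oS).
by apply: connect_trans (jj' l m lS mS) (j'j'' m l'' mS l''S).
Qed.

Let cc_edge j l j' l' : (j, l) \notin S -> (j', l') \notin S ->
  nb_adj (j, l) (j', l') -> cc j j'.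
Proof.
move=> lS l'S ll' m m' mS m'S.
apply: (connect_trans (cc_refl mS lS)); apply: connect_trans (cc_refl l'S m'S).
by apply: connect1; rewrite /del_adj /= lS l'S.
Qed.

Let link_hit j := [exists w in S, (w == (j, srcB r)) || (w == (nxt j, inl Q))].
Let chord_hit j := [exists w in S, (w == (j, srcA r)) || (w == (mate j, srcA r))].

Let cc_link j : ~~ link_hit j -> cc j (nxt j).
Proof.
move/existsPn=> nh; apply: (cc_edge _ _ (link_adj j)).
  by have := nh (j, srcB r); rewrite eqxx andbT.
by have := nh (nxt j, inl Q); rewrite eqxx orbT andbT.
Qed.

Let cc_chord j : ~~ chord_hit j -> cc j (mate j).
Proof.
move/existsPn=> nh; apply: (cc_edge _ _ (chord_adj j)).
  by have := nh (j, srcA r); rewrite eqxx andbT.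
by have := nh (mate j, srcA r); rewrite eqxx orbT andbT.
Qed.

Let cc_links a k :
  (forall j, 0 < j -> j <= k -> ~~ link_hit (iter j nxt a)) ->
  cc (nxt a) (iter k.+1 nxt a).
Proof.
elim: k => [|k IHk] nh; first exact: cc_refl.
apply: cc_trans (IHk _) (cc_link (nh k.+1 _ _)) => // j j0 jk.
by apply: nh => //; apply: leqW.
Qed.

Let srcA_neqB : (srcA r == srcB r) = false.
Proof.
have [->|[j jr ->]] := srcA_cases (leqnn r);
  have [->|[j' j'r ->]] := srcB_cases (leqnn r); rewrite ?hub_blk ?blk_hub //.
by rewrite blk_eq // andbF.
Qed.

Let srcA_neqQ : (srcA r == inl Q) = false.
Proof. by rewrite -(congr1 srcA (prednK r_gt0)) /= blk_hub // prednK. Qed.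

Let srcB_neqQ : (srcB r == inl Q) = false.
Proof. by rewrite -(congr1 srcB (prednK r_gt0)) /= blk_hub // prednK. Qed.

Let locE := (srcA_neqB, srcA_neqQ, srcB_neqQ,
  etrans (eq_sym _ _) srcA_neqB, etrans (eq_sym _ _) srcA_neqQ,
  etrans (eq_sym _ _) srcB_neqQ).

(** Distinct links have no common end, so each link hit costs one of the two deletions. *)
Let two_links a b c : a != b -> link_hit a -> link_hit b -> link_hit c ->
  (c == a) || (c == b).
Proof.
move=> ab /exists_inP[u uS ua] /exists_inP[v vS vb] /exists_inP[w wS wc].
apply/idPn; rewrite negb_or => /andP[ca cb]; apply: (del_three S2 uS vS wS).
have neq x y (p q : gr) : x != y ->
    (p == (x, srcB r)) || (p == (nxt x, inl Q)) ->
    (q == (y, srcB r)) || (q == (nxt y, inl Q)) -> p != q.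
  move=> xy /orP[]/eqP-> /orP[]/eqP->;
    rewrite xpair_eqE ?locE ?andbF // ?(can_eq nxtK) negb_and xy //.
by rewrite /= !inE negb_or (neq a b) // (neq a c) ?(neq b c) // eq_sym.
Qed.

(** For [0 < r] the ends of chords differ from those of links, so a chord hit costs a deletion of
    its own. *)
Let chord_link a b c : a != b -> link_hit a -> link_hit b -> chord_hit c -> False.
Proof.
move=> ab /exists_inP[u uS ua] /exists_inP[v vS vb] /exists_inP[w wS wc].
apply: (del_three S2 uS vS wS).
have neq x y (p q : gr) : x != y ->
    (p == (x, srcB r)) || (p == (nxt x, inl Q)) ->
    (q == (y, srcB r)) || (q == (nxt y, inl Q)) -> p != q.
  move=> xy /orP[]/eqP-> /orP[]/eqP->;
    rewrite xpair_eqE ?locE ?andbF // ?(can_eq nxtK) negb_and xy //.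
have neq' x y (p q : gr) :
    (p == (x, srcB r)) || (p == (nxt x, inl Q)) ->
    (q == (y, srcA r)) || (q == (mate y, srcA r)) -> p != q.
  by move=> /orP[]/eqP-> /orP[]/eqP->; rewrite xpair_eqE ?locE ?andbF.
by rewrite /= !inE negb_or (neq a b) // (neq' a c) // (neq' b c).
Qed.

Lemma spread_link a : cc a (nxt a).
Proof.
have [ha|] := boolP (link_hit a); last exact: cc_link.
have iter_a j : 0 < j -> j < order nxt a -> iter j nxt a != a.
  by move=> j0 jo; rewrite eq_sym (@iter_nxt_inj a 0).
have around : (forall b, b != a -> ~~ link_hit b) -> cc a (nxt a).
  move=> nh; apply: cc_sym.
  have aE := iter_findex (nxt_conn (nxt a) a).
  rewrite -{2}aE -iterSr; apply: cc_links => j j0 jk; apply: nh; apply: iter_a => //.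
  apply: leq_ltn_trans jk _.
  have -> : order nxt a = order nxt (nxt a).
    by apply: eq_card => x; rewrite !inE !nxt_conn.
  exact: findex_max.
(* A chord hit takes the second deletion, so the rest of the ring is a detour. *)
have [/orP ch|] := boolP (chord_hit a || chord_hit (nxt a)).
  apply: around => b ba; apply/negP => hb.
  by case: ch; apply: (@chord_link a b) => //; rewrite eq_sym.
rewrite negb_or => /andP[/cc_chord ca /cc_chord cna].
(* Both chords are free. If the link at [mate a] is free too, it joins their far ends by
   [mate_nxt]. *)
have [hm|hm] := boolP (link_hit (mate a)); last first.
  apply: (cc_trans ca); apply: (cc_trans (cc_link hm)).
  by rewrite -mate_nxt; apply: cc_sym.
(* Here the links at [a] and [mate a] take both deletions, and the ring is free from [nxt a] to
   [mate a]. *)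
apply: (cc_trans ca); apply: cc_sym.
have mE := iter_findex (nxt_conn a (mate a)).
have mo := findex_max (nxt_conn a (mate a)).
move: mE mo; case: (findex nxt a (mate a)) => [|m] mE mo.
  by have := mate_neq a; rewrite -mE eqxx.
rewrite -mE; apply: cc_links => j j0 jm; apply/negP => hj.
have am : a != mate a by rewrite eq_sym.
have := two_links am ha hm hj; rewrite (negbTE (iter_a j j0 _)) /=; last first.
  by apply: leq_ltn_trans jm (ltnW mo).
by rewrite -mE; apply/negP; apply: iter_nxt_inj.
Qed.

Lemma del_spread (u v : gr) : u \notin S -> v \notin S -> u ~~> v.
Proof.
case: u v => [j l] [j' l']; suff: cc j j' by apply.
rewrite -(iter_findex (nxt_conn j j')); elim: findex => [|k IHk].
  exact: cc_refl.
by apply: (cc_trans IHk); apply: spread_link.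
Qed.

End Spread.
End Deletion.

(** * Connectivity bounds and cuts *)

Lemma connected2 (S : {set gr}) : inhabited I -> #|S| < 2 -> del_connected S.
Proof.
move=> [i0] S1; have [i iS] : exists i, forall u, u \in S -> u.1 = i.
  have [->|[w wS]] := set_0Vmem S; first by exists i0 => u; rewrite inE.
  by exists w.1 => u uS; rewrite (card_le1_eqP S1 _ _ uS wS).
apply/forallP => u; apply/forallP => v; apply/implyP => uS; apply/implyP => vS.
apply: (del_same iS) => // l lS; case: (posnP r) => r0.
  exact: escape0.
by apply: escape => //; apply: ltnW.
Qed.

Lemma connected3 (S : {set gr}) : inhabited I -> 0 < r ->
  (forall j, mate (nxt j) = nxt (mate j)) -> #|S| < 3 -> del_connected S.
Proof.
move=> [i0] r0 mn S2.
apply/forallP => u; apply/forallP => v; apply/implyP => uS; apply/implyP => vS.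
have [/existsP[w1 /existsP[w2 /and3P[w1S w2S w12]]]|same] :=
  boolP [exists w1, exists w2, [&& w1 \in S, w2 \in S & w1.1 != w2.1]].
  exact: (del_spread r0 mn S2 w1S w2S w12).
have [i iS] : exists i, forall u, u \in S -> u.1 = i.
  have [->|[w wS]] := set_0Vmem S; first by exists i0 => x; rewrite inE.
  exists w.1 => x xS; apply/eqP; have /existsPn/(_ w) := existsPn same x.
  by rewrite xS wS /= negbK.
by apply: (del_same iS) => // l lS; apply: escape.
Qed.

(** The three neighbours of the cubic vertex [Two] isolate it. *)
Lemma cut3 (i : I) : exists2 S : {set gr}, #|S| = 3 & ~~ del_connected S.
Proof.
pose u : gr := (i, inl Two); pose S : {set gr} := [set v in nb u].
exists S; first by rewrite cardsE (card_uniqP (nb_uniq u)).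
apply/negP => /forallP/(_ u)/forallP/(_ (mate i, inl Two)).
have -> : u \notin S by rewrite inE nb_irrefl.
have -> : (mate i, inl Two) \notin S.
  by rewrite inE /nb /nb_hub !inE !xpair_eqE (negbTE (mate_neq i)).
case/connectP=> [[|v p]] /=.
  by move=> _ [/eqP]; rewrite (negbTE (mate_neq i)).
by case/andP=> /and3P[_]; rewrite inE => /negP.
Qed.

(** Two consecutive copies that are mates are attached to the rest by two links only, and the end of
    each inside the pair is deleted. *)
Lemma cut2 (i i' : I) : mate i = nxt i -> i' != i -> i' != mate i ->
  exists2 S : {set gr}, #|S| = 2 & ~~ del_connected S.
Proof.
move=> mi i'i i'm; pose u : gr := (i, inl Q); pose v : gr := (nxt i, srcB r).
have ni : nxt i != i by rewrite -mi mate_neq.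
exists [set u; v]; first by rewrite cards2 xpair_eqE eq_sym (negbTE ni).
set S := [set u; v]; apply/negP => conn.
pose X : {pred gr} := [pred w | (w.1 == i) || (w.1 == nxt i)].
have clX : closed (@del_adj gr S) X.
  apply: (intro_closed (del_sym S)) => x y /and3P[xS yS]; rewrite !inE => xy xX.
  case: (nb_out xy) => [->//|[_ ->]|[xE ->]|[xE ->]] /=.
  - by case/orP: xX => /eqP->; rewrite -mi ?mateK eqxx ?orbT.
  - case/orP: xX => /eqP xi; rewrite xi in xE *; first by rewrite eqxx orbT.
    by rewrite xE !inE eqxx orbT in xS.
  case/orP: xX => /eqP xi; rewrite xi in xE *; last by rewrite nxtK eqxx.
  by rewrite xE !inE eqxx in xS.
have YS j : (j, inl Y) \notin S.
  rewrite !inE !xpair_eqE andbF /=.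
  by have [->|[j' j'r ->]] := srcB_cases (leqnn r); rewrite ?hub_blk ?andbF.
have /implyP/(_ (YS i))/implyP/(_ (YS i')) :=
  forallP (forallP conn (i, inl Y)) (i', inl Y).
move/(closed_connect clX); rewrite !inE /= eqxx -mi.
by rewrite (negbTE i'i) (negbTE i'm).
Qed.

End Graph.

Lemma connectivity_eq (G : sgraph) k (S : {set G}) :
  k_connected G k -> #|S| = k -> ~~ del_connected S -> connectivity G = k.
Proof.
move=> Gk Sk nS; have /andP[kG _] := Gk.
apply/eqP; rewrite eqn_leq; apply/andP; split.
  apply/bigmax_leqP => j /andP[_ /forallP/(_ S)]; rewrite Sk.
  by rewrite (negbTE nS) implybF -leqNgt.
exact: (@leq_bigmax_cond _ _ (fun j : 'I_#|G| => nat_of_ord j) (Ordinal kG)).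
Qed.

(** * Rings of even length and the two choices of mates *)

Section Ring.

Variable t : nat.

Local Notation n := (t.+2 + t.+2).

Definition opposite : 'I_n -> 'I_n := iter t.+2 (@ordS n).

(** The length [n] is even, so pairing each even index with its successor is consistent around the
    ring. *)
Definition twin (i : 'I_n) : 'I_n := if odd i then ord_pred i else ordS i.

Lemma val_iter_ordS k (i : 'I_n) : iter k (@ordS n) i = (i + k) %% n :> nat.
Proof.
elim: k => [|k IHk]; first by rewrite addn0 modn_small.
by rewrite iterS [LHS]/= IHk; have := modnDml (i + k) 1 n; rewrite !addn1 (addnS i k).
Qed.

Lemma ordS_conn (i j : 'I_n) : fconnect (@ordS n) i j.
Proof.
suff -> : j = iter (n - i + j) (@ordS n) i by apply: fconnect_iter.
apply: val_inj; rewrite [RHS]val_iter_ordS addnA subnKC 1?ltnW //.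
by rewrite modnDl modn_small.
Qed.

Lemma odd_n : odd n = false.
Proof. by rewrite oddD addbb. Qed.

Lemma odd_ordS (i : 'I_n) : odd (ordS i) = ~~ odd i.
Proof. by rewrite /= odd_mod ?odd_n. Qed.

Lemma ordS_neq (i : 'I_n) : ordS i != i.
Proof. by apply/eqP => /(congr1 (odd \o val)) /=; rewrite odd_ordS; case: odd. Qed.

Lemma odd_ord_pred (i : 'I_n) : odd (ord_pred i) = ~~ odd i.
Proof. by rewrite -{2}[i]ord_predK odd_ordS negbK. Qed.

Lemma twinK : involutive twin.
Proof.
move=> i; rewrite {2}/twin; case: ifP => oi; rewrite /twin.
  by rewrite odd_ord_pred oi ord_predK.
by rewrite odd_ordS oi ordSK.
Qed.

Lemma twin_neq i : twin i != i.
Proof.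
rewrite /twin; case: ifP => _; last exact: ordS_neq.
by rewrite -{2}[i]ord_predK eq_sym ordS_neq.
Qed.

Lemma oppositeK : involutive opposite.
Proof.
move=> i; rewrite /opposite -iterD; apply: val_inj.
by rewrite [LHS]val_iter_ordS modnDr modn_small.
Qed.

Lemma opposite_neq i : opposite i != i.
Proof.
apply/eqP => /(congr1 val); rewrite [LHS]val_iter_ordS.
(* The sum [i + t.+2] wraps around exactly when [i] is in the second half. *)
have [im|mi] := ltnP i t.+2.
  rewrite modn_small ?ltn_add2r // => /eqP.
  by rewrite -[X in _ == X]addn0 eqn_add2l.
have [k iE] : exists k, i = t.+2 + k :> nat by exists (i - t.+2); rewrite subnKC.
have kn : k < n by apply: leq_ltn_trans (ltn_ord i); rewrite iE leq_addl.
rewrite [X in X + _]iE addnAC modnDl modn_small //= iE => /eqP.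
by rewrite -[X in X == _]add0n eqn_add2r.
Qed.

Lemma opposite_ordS i : opposite (ordS i) = ordS (opposite i).
Proof. by rewrite /opposite -iterSr. Qed.

Lemma ring_third (mate : 'I_n -> 'I_n) i : exists2 j, j != i & j != mate i.
Proof.
have /card_gt0P[j] : 0 < #|~: [set i; mate i]|.
  have := cardsC [set i; mate i]; rewrite card_ord cards2.
  by move: #|~: _| (i != _) => [|c] [] //; rewrite addn0 !addnS.
by rewrite !inE negb_or => /andP[]; exists j.
Qed.

End Ring.

Lemma isomorphic_card (G H : sgraph) : isomorphic G H -> #|G| = #|H|.
Proof. by case=> f [/bij_eq_card]. Qed.

(** Rings of different lengths have different numbers of vertices, hence are not isomorphic. *)
Lemma infinitely_many_rings r kappa
    (mate : forall t, 'I_(t.+2 + t.+2) -> 'I_(t.+2 + t.+2))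
    (mateK : forall t, involutive (@mate t)) (mate_neq : forall t i, mate t i != i) :
  (forall t, connectivity
     (gr r (@ordSK _) (@ord_predK _) (@mateK t) (@mate_neq t)) = kappa) ->
  infinitely_many_graphs (fun G : sgraph =>
    [/\ biregular 3 (2 * r.+1) G, uniquely_hamiltonian G & connectivity G = kappa]).
Proof.
move=> conn; exists (fun t => gr r (@ordSK _) (@ord_predK _) (@mateK t) (@mate_neq t)).
split=> [t|t u tu /isomorphic_card].
  split=> //; last first.
    apply: gr_uniquely_hamiltonian; [exact: ordS_conn | exact: ring_third |].
    exact: (inhabits ord0).
  split; last by exists (ord0, inl Y); apply: gr_degree_Y.
    case=> i l; have [->|lY] := eqVneq l (inl Y).
      by right; apply: gr_degree_Y.
    by left; apply: gr_degree3.
  by exists (ord0, inl One); apply: gr_degree3.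
rewrite !card_gr !card_ord => /eqP; rewrite eqn_pmul2r // !addnn => /eqP.
by move/double_inj => [].
Qed.

(** The construction is used with [k = r.+1]. The pair [kappa = 3], [k = 1] is excluded because a
    vertex of degree 2 bounds the connectivity by 2. *)
Theorem theorem9 (kappa k : nat)
    (hkappa : kappa = 2 \/ kappa = 3)
    (hk : 0 < k)
    (hk3 : kappa = 3 -> k <> 1) :
  infinitely_many_graphs (fun G : sgraph =>
    [/\ biregular 3 (2 * k) G, uniquely_hamiltonian G & connectivity G = kappa]).
Proof.
case: k hk hk3 => // r _ r0; case: hkappa r0 => -> r0.
  apply: (infinitely_many_rings (mateK := twinK) (mate_neq := twin_neq)) => t.
  have [j ji jm] := ring_third (@twin t) ord0.
  (* Index 0 is even, so its twin is its successor, as [cut2] requires. *)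
  have [|S S2 nS] := cut2 r (@ordSK _) (@ord_predK _) (@twinK t) (@twin_neq t) _ ji jm.
    by [].
  apply: connectivity_eq S2 nS; apply/andP; split.
    by rewrite card_gr card_ord.
  apply/forallP => S'; apply/implyP.
  exact: (connected2 (@ordS_conn t) (@ordS_neq t) (inhabits ord0)).
have {}r0 : 0 < r by rewrite lt0n; apply/eqP => rE; apply: r0; rewrite ?rE.
apply: (infinitely_many_rings (mateK := oppositeK) (mate_neq := opposite_neq)) => t.
have [S S3 nS] := cut3 r (@ordSK _) (@ord_predK _) (@oppositeK t) (@opposite_neq t) ord0.
apply: connectivity_eq S3 nS; apply/andP; split.
  by rewrite card_gr card_ord.
apply/forallP => S'; apply/implyP.
apply: (connected3 (@ordS_conn t) (@ordS_neq t) (inhabits ord0)) => //.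
exact: opposite_ordS.
Qed.
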